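(* Let $1 \leq p < \infty$. The following are equivalent for two Banach lattices $E$ and $F$: (a) $E^*$ has order continuous norm or $F^*$ has the positive Schur property of order $p$. (b) The adjoint of every positive almost weak $p$-convergent operator from $E$ to $F$ is disjoint $p$-convergent. (c) For every positive operator $T \colon E \to F$, $T$ is almost weak $p$-convergent if and only if $T^*\colon F^*\to E^*$ is disjoint $p$-convergent.
   Context: All operators are linear and bounded. A sequence $(x_n)_n$ in a Banach lattice is disjoint if $|x_n|\wedge|x_m|=0$ for $n\neq m$. A sequence $(x_n)_n$ in a Banach space $Z$ is weakly $p$-summable if $(x^*(x_n))_n \in \ell_p$ for every $x^* \in Z^*$. A linear operator from a Banach lattice to a Banach space is disjoint $p$-convergent if it sends disjoint weakly $p$-summable sequences to norm null sequences. A linear operator $T\colon E\to F$ between Banach lattices is almost weak $p$-convergent if $y_n^*(T x_n)\to 0$ whenever $(x_n)_n$ is weakly null in $E$ and $(y_n^* )_n$ is disjoint weakly $p$-summable in $F^*$. A Banach lattice $E$ has the positive Schur property of order $p$ if every weakly $p$-summable sequence $(x_n)_n\subseteq E^+$ is norm null. *)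

(* Defs.v *)
From HB Require Import structures.
From mathcomp Require Import all_boot all_order all_algebra.
From mathcomp Require Import mathcomp_extra boolp classical_sets functions.
From mathcomp Require Import reals topology normedtype sequences exp.

Set Implicit Arguments.
Unset Strict Implicit.
Unset Printing Implicit Defensive.

Import Order.TTheory GRing.Theory Num.Theory.
Import numFieldNormedType.Exports.

Local Open Scope classical_set_scope.
Local Open Scope ring_scope.


(** For linear maps between normed spaces, continuous and bounded mean the same
    ([linear_bounded_continuous]). *)
Record boundedOp (R : realType) (E F : normedModType R) := BoundedOp {
  boundedOp_fun :> E -> F;
  boundedOpP : linear boundedOp_fun /\ continuous boundedOp_fun
}.

Section boundedOp.
Context {R : realType} {E F : normedModType R}.
Implicit Types S T : boundedOp E F.

Definition bounded_op : {pred E -> F} :=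
  mem [set f : E -> F | linear f /\ continuous f].

Let Sub f (Pf : f \in bounded_op) : boundedOp E F := BoundedOp (set_mem Pf).

Let rect (K : boundedOp E F -> Type) :
  (forall f (Pf : f \in bounded_op), K (Sub Pf)) -> forall u, K u.
Proof.
move=> KS [f Pf]; have Qf : f \in bounded_op by exact: mem_set.
by rewrite (Prop_irrelevance Pf (set_mem Qf)); exact: KS.
Qed.

Let SubK f (Pf : f \in bounded_op) : boundedOp_fun (Sub Pf) = f.
Proof. by []. Qed.

HB.instance Definition _ := isSub.Build (E -> F) _ (boundedOp E F) rect SubK.
HB.instance Definition _ := [Choice of boundedOp E F by <:].

Lemma bounded_op_submod_closed : submod_closed bounded_op.
Proof.
split=> [|a f g]; rewrite !inE => /=.
  by split=> [b x y|]; [rewrite scaler0 addr0|exact: cst_continuous].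
move=> [lf cf] [lg cg]; split=> [b x y|x] /=.
  rewrite !fctE lf lg !scalerDr !scalerA (mulrC a b) -!addrA; congr (_ + _).
  by rewrite addrCA.
apply: cvgD; last exact: cg.
by apply: cvgZr; exact: cf.
Qed.

HB.instance Definition _ :=
  GRing.isSubmodClosed.Build R (E -> F) bounded_op bounded_op_submod_closed.
HB.instance Definition _ := [SubChoice_isSubLmodule of boundedOp E F by <:].

HB.instance Definition _ T :=
  GRing.isLinear.Build R E F *:%R (boundedOp_fun T) (proj1 (boundedOpP T)).

Lemma boundedOp_continuous T : continuous T. Proof. exact: (boundedOpP T).2. Qed.

Lemma boundedOpDE S T x : (S + T) x = S x + T x. Proof. by []. Qed.
Lemma boundedOpNE T x : (- T) x = - T x. Proof. by []. Qed.
Lemma boundedOpBE S T x : (S - T) x = S x - T x. Proof. by []. Qed.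
Lemma boundedOpZE a T x : (a *: T) x = a *: T x. Proof. by []. Qed.
Lemma boundedOp0E x : (0 : boundedOp E F) x = 0. Proof. by []. Qed.

Lemma boundedOp_eqP S T : S = T <-> S =1 T.
Proof. by split=> [->//|ST]; apply/val_inj/funext. Qed.

Definition op_norm T : R := sup [set `|T x| | x in [set x : E | `|x| <= 1]].

Lemma linear_bound_continuous (f : E -> F) (M : R) : linear f ->
  (forall x, `|f x| <= M * `|x|) -> continuous f.
Proof.
move=> lf fM; pose g : {linear E -> F} :=
  HB.pack f (GRing.isLinear.Build R E F *:%R f lf).
rewrite -[f]/(g : E -> F); apply: bounded_linear_continuous.
apply/linear_boundedP; near=> r => x; apply: (le_trans (fM x)).
by rewrite ler_wpM2r//; near: r; apply: nbhs_pinfty_ge; exact: num_real.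
Unshelve. all: by end_near. Qed.

Lemma boundedOp_bound T : exists2 M, 0 <= M & forall x, `|T x| <= M * `|x|.
Proof.
pose f : {linear E -> F} := boundedOp_fun T.
have /linear_bounded_continuous/linear_boundedP : continuous f.
  exact: boundedOp_continuous.
move=> /pinfty_ex_gt0[M M0 TM]; exists M => //; exact: ltW.
Qed.

Let op_norm_set_has_sup T :
  has_sup [set `|T x| | x in [set x : E | `|x| <= 1]].
Proof.
split; first by exists `|T 0|; exists 0 => //=; rewrite normr0.
have [M M0 TM] := boundedOp_bound T; exists M => _ [x /= x1 <-].
by rewrite (le_trans (TM x))// ler_piMr.
Qed.

Lemma op_norm_ge0 T : 0 <= op_norm T.
Proof.
apply: (@le_trans _ _ `|T 0|) => //; apply: ub_le_sup.
  exact: (op_norm_set_has_sup T).2.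
by exists 0 => //=; rewrite normr0.
Qed.

Lemma op_normP T x : `|T x| <= op_norm T * `|x|.
Proof.
have [->|x0] := eqVneq x 0; first by rewrite linear0 !normr0 mulr0.
have nx0 : 0 < `|x| by rewrite normr_gt0.
rewrite -ler_pdivrMr// mulrC -[X in X * _]gtr0_norm ?invr_gt0// -normrZ -linearZ.
apply: ub_le_sup; first exact: (op_norm_set_has_sup T).2.
exists (`|x|^-1 *: x) => //=.
by rewrite normrZ gtr0_norm ?invr_gt0// mulVf// gt_eqF.
Qed.

Lemma op_norm_le T (M : R) : 0 <= M ->
  (forall x, `|T x| <= M * `|x|) -> op_norm T <= M.
Proof.
move=> M0 TM; apply: ge_sup; first exact: (op_norm_set_has_sup T).1.
by move=> _ [x /= x1 <-]; rewrite (le_trans (TM x))// ler_piMr.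
Qed.

Let op_normD S T : op_norm (S + T) <= op_norm S + op_norm T.
Proof.
apply: op_norm_le => [|x]; first by rewrite addr_ge0 ?op_norm_ge0.
by rewrite mulrDl (le_trans (ler_normD _ _))// lerD ?op_normP.
Qed.

Let op_normZ a T : op_norm (a *: T) = `|a| * op_norm T.
Proof.
have le b S : op_norm (b *: S) <= `|b| * op_norm S.
  apply: op_norm_le => [|x]; first by rewrite mulr_ge0 ?op_norm_ge0.
  by rewrite boundedOpZE normrZ -mulrA ler_wpM2l ?op_normP.
apply/eqP; rewrite eq_le le /=.
have [->|a0] := eqVneq a 0; first by rewrite normr0 mul0r op_norm_ge0.
rewrite -ler_pdivlMl ?normr_gt0// -normfV.
by rewrite -[X in op_norm X <= _](scalerK a0) le.
Qed.

Let op_norm_eq0 T : op_norm T = 0 -> T = 0.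
Proof.
move=> T0; apply/boundedOp_eqP => x; apply/eqP; rewrite -normr_le0.
by have := op_normP T x; rewrite T0 mul0r.
Qed.

HB.instance Definition _ :=
  Lmodule_isNormed.Build R (boundedOp E F) op_normD op_normZ op_norm_eq0.

Lemma boundedOp_normE T : `|T| = op_norm T. Proof. by []. Qed.

End boundedOp.

Section boundedOp_complete.
Context {R : realType} {E : normedModType R} {F : completeNormedModType R}.

Lemma boundedOp_complete (G : set_system (boundedOp E F)) :
  ProperFilter G -> cauchy G -> cvg G.
Proof.
move=> FG /cauchyP Gc.
have {}Gc (e : R) : 0 < e ->
    exists T : boundedOp E F, {near G, forall S : boundedOp E F, `|T - S| < e}.
  by move=> /Gc[T GT]; exists T; move: GT; rewrite -ball_normE.
have ev (T S : boundedOp E F) (e : R) x : `|T - S| < e -> `|T x - S x| <= e * `|x|.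
  move=> /ltW TSe; rewrite -boundedOpBE (le_trans (op_normP _ _))//.
  by rewrite ler_wpM2r.
have cx x : cvg ((fun T : boundedOp E F => T x) @ G).
  apply: cauchy_cvg; apply/cauchyP => e e0.
  have e'0 : 0 < e / (`|x| + 1) by rewrite divr_gt0// ltr_wpDl.
  have [T GT] := Gc _ e'0; exists (T x).
  change ({near G, forall S : boundedOp E F, ball (T x) e (S x)}).
  near=> S; rewrite -ball_normE /ball_ /=.
  have TS : `|T - S| < e / (`|x| + 1) by near: S.
  rewrite (le_lt_trans (ev _ _ _ x TS))// mulrAC ltr_pdivrMr ?ltr_wpDl//.
  by rewrite ltr_pM2l// ltrDl.
pose L x := lim ((fun T : boundedOp E F => T x) @ G).
have Ll : linear L.
  move=> a x y; apply/cvg_lim => //.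
  rewrite [X in X @ _ --> _](_ : _ = (fun T : boundedOp E F => a *: T x + T y)).
    by apply: cvgD; [apply: cvgZr; exact: cx|exact: cx].
  by apply/funext => T; rewrite linearP.
have Lev (T : boundedOp E F) (e : R) : {near G, forall S : boundedOp E F, `|T - S| < e} ->
    forall x, `|T x - L x| <= e * `|x|.
  move=> GT x.
  have c : (fun S : boundedOp E F => `|T x - S x|) @ G --> `|T x - L x|.
    by apply: cvg_norm; apply: cvgB; [exact: cvg_cst|exact: cx].
  apply: (@closed_cvg _ _ G _ _ [set r | r <= e * `|x|] _ _ _ c).
    exact: closed_le.
  by near=> S; apply: ev; near: S.
have [T0 GT0] := Gc 1 ltr01.
have Lc : continuous L.
  apply: (@linear_bound_continuous _ _ _ _ (op_norm T0 + 1)) => // x.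
  rewrite -[L x](subKr (T0 x)) (le_trans (ler_normB _ _))// mulrDl lerD//.
    exact: op_normP.
  exact: Lev.
apply/cvg_ex; exists (BoundedOp (conj Ll Lc)).
apply/cvgrPdist_le => e e0.
have [T GT] := Gc (e / 2) (divr_gt0 e0 (ltr0n _ 2)).
near=> S.
rewrite -(subrKA T) (splitr e) (le_trans (ler_normD _ _))// lerD//.
  rewrite distrC; apply: op_norm_le; first by rewrite divr_ge0// ltW.
  by move=> x; rewrite boundedOpBE; exact: Lev.
by apply: ltW; near: S.
Unshelve. all: by end_near. Qed.

HB.instance Definition _ :=
  Uniform_isComplete.Build (boundedOp E F) boundedOp_complete.

End boundedOp_complete.


(** MathComp declares [numDomainType] before any join of its order structures
    with normed modules, so such a join can no longer be added to the hierarchy.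
    The order is thus part of the mixin; the library's lattice structure, with
    its notations and theory, is recovered right after. *)
HB.mixin Record isBanachLattice (R : realType) E
    & CompleteNormedModule R E := {
  vle : rel E;
  vmeet : E -> E -> E;
  vjoin : E -> E -> E;
  vle_refl : reflexive vle;
  vle_anti : antisymmetric vle;
  vle_trans : transitive vle;
  vmeetP : forall x y z, vle x (vmeet y z) = vle x y && vle x z;
  vjoinP : forall x y z, vle (vjoin x y) z = vle x z && vle y z;
  vle_add2r : forall z x y, vle x y -> vle (x + z) (y + z);
  vscale_ge0 : forall (a : R) x, 0 <= a -> vle 0 x -> vle 0 (a *: x);
  vle_norm : forall x y,
    vle (vjoin x (- x)) (vjoin y (- y)) -> `|x| <= `|y|
}.

#[short(type="banachLatticeType")]
HB.structure Definition BanachLattice (R : realType) :=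
  {E of CompleteNormedModule R E & isBanachLattice R E}.

HB.instance Definition _ (R : realType) (E : banachLatticeType R) :=
  Order.Le_isPOrder.Build ring_display (BanachLattice.sort E)
    (@vle_refl R E) (@vle_anti R E) (@vle_trans R E).
HB.instance Definition _ (R : realType) (E : banachLatticeType R) :=
  Order.POrder_MeetJoin_isLattice.Build ring_display (BanachLattice.sort E)
    (@vmeetP R E) (@vjoinP R E).

Definition labs (R : realType) (E : banachLatticeType R) (x : E) : E :=
  (x `|` - x)%O.

Section banach_lattice_theory.
Context {R : realType} {E : banachLatticeType R}.
Implicit Types (x y z u v : E) (a : R).

Lemma lev_add2r z x y : x <= y -> x + z <= y + z.
Proof. exact: vle_add2r. Qed.

Lemma scalev_ge0 a x : 0 <= a -> 0 <= x -> 0 <= a *: x.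
Proof. exact: vscale_ge0. Qed.

Lemma labs_le_norm x y : labs x <= labs y -> `|x| <= `|y|.
Proof. exact: vle_norm. Qed.

Lemma subv_ge0 x y : (0 <= y - x) = (x <= y).
Proof.
by apply/idP/idP => [/(lev_add2r x)|/(lev_add2r (- x))];
  rewrite ?subrK ?add0r ?subrr.
Qed.

Lemma addv_ge0 x y : 0 <= x -> 0 <= y -> 0 <= x + y.
Proof. by move=> x0 /(lev_add2r x); rewrite add0r addrC; exact: le_trans. Qed.

Lemma lev_add x y z u : x <= y -> z <= u -> x + z <= y + u.
Proof.
move=> xy zu; apply: (le_trans (lev_add2r z xy)).
by rewrite [y + z]addrC [y + u]addrC lev_add2r.
Qed.

Lemma lev_opp x y : x <= y -> - y <= - x.
Proof. by move=> xy; rewrite -subv_ge0 opprK addrC subv_ge0. Qed.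

Lemma oppv_le0 x : 0 <= x -> - x <= 0.
Proof. by move=> /lev_opp; rewrite oppr0. Qed.

Lemma labs_ge x : x <= labs x.
Proof. by rewrite /labs leUl. Qed.

Lemma labs_geN x : - x <= labs x.
Proof. by rewrite /labs leUr. Qed.

Lemma labs_le x y : x <= y -> - x <= y -> labs x <= y.
Proof. by move=> xy nxy; rewrite /labs leUx xy. Qed.

Lemma scale2_half x : 2^-1 *: (x + x) = x.
Proof. by rewrite -mulr2n -(scaler_nat 2 x) scalerA mulVf ?scale1r// pnatr_eq0. Qed.

Lemma labs_ge0 x : 0 <= labs x.
Proof.
rewrite -[labs x]scale2_half scalev_ge0// ?invr_ge0//.
by rewrite -(subrr x) lev_add ?labs_ge ?labs_geN.
Qed.

Lemma ge0_labs x : 0 <= x -> labs x = x.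
Proof.
move=> x0; apply/eqP; rewrite eq_le labs_ge labs_le//.
by rewrite (le_trans (oppv_le0 x0)).
Qed.

Lemma norm_labs x : `|labs x| = `|x|.
Proof.
have xx : labs (labs x) = labs x by rewrite ge0_labs ?labs_ge0.
by apply/eqP; rewrite eq_le !labs_le_norm ?xx.
Qed.

Lemma ge0_norm_le x y : 0 <= x -> x <= y -> `|x| <= `|y|.
Proof.
by move=> x0 xy; rewrite labs_le_norm// !ge0_labs//; exact: le_trans xy.
Qed.

Lemma riesz_decomposition x y z : 0 <= x -> 0 <= y -> 0 <= z -> z <= x + y ->
  exists z1 z2, [/\ z = z1 + z2, 0 <= z1 <= x & 0 <= z2 <= y].
Proof.
move=> x0 y0 z0 zxy; pose z2 := ((z - x) `|` 0)%O.
have z2ge : z - x <= z2 by rewrite /z2 leUl.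
have z2le : z2 <= z.
  rewrite /z2 leUx z0 andbT.
  by have := lev_add2r z (oppv_le0 x0); rewrite add0r addrC.
have z1x : z - z2 <= x.
  have := lev_add2r (x - z2) z2ge.
  by rewrite addrA subrK addrCA subrr addr0.
have z2y : z2 <= y.
  rewrite /z2 leUx y0 andbT.
  by have := lev_add2r (- x) zxy; rewrite addrAC subrr add0r.
by exists (z - z2), z2; rewrite subrK subv_ge0 z2le z1x z2y /z2 leUr.
Qed.

End banach_lattice_theory.


(** In the Banach lattice case, the order is the pointwise order on the positive cone; the norm
    is the operator norm. *)
Definition dual (R : realType) (Z : normedModType R) : Type :=
  boundedOp Z R^o.

HB.instance Definition _ (R : realType) (Z : normedModType R) :=
  CompleteNormedModule.on (dual Z).

(** Riesz-Kantorovich: the positive part of [h], given on the positive cone by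
    [fun x => sup [set h y | y in [set y | 0 <= y <= x]]]. *)
Section dual_lattice.
Context {R : realType} {E : banachLatticeType R}.
Implicit Types (f g h k : dual E) (x y z u v : E) (a : R).

Definition dual_le f g := `[< forall x, 0 <= x -> f x <= g x >].

Lemma dual_leP f g : reflect (forall x, 0 <= x -> f x <= g x) (dual_le f g).
Proof. exact: asboolP. Qed.

Let decomp x : x = (labs x + x) - labs x.
Proof. by rewrite addrAC subrr add0r. Qed.

Let labsD_ge0 x : 0 <= labs x + x.
Proof. by rewrite -[X in _ + X]opprK subv_ge0 labs_geN. Qed.

Let dual_le_refl : reflexive dual_le.
Proof. by move=> f; apply/dual_leP. Qed.

Let dual_le_anti : antisymmetric dual_le.
Proof.
move=> f g /andP[/dual_leP fg /dual_leP gf]; apply/boundedOp_eqP => x.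
have e y : 0 <= y -> f y = g y by move=> y0; apply/eqP; rewrite eq_le fg ?gf.
by rewrite (decomp x) !linearB/= !e ?labs_ge0.
Qed.

Let dual_le_trans : transitive dual_le.
Proof.
move=> g f h /dual_leP fg /dual_leP gh; apply/dual_leP => x x0.
exact: le_trans (fg _ x0) (gh _ x0).
Qed.

HB.instance Definition _ := Order.Le_isPOrder.Build ring_display (dual E)
  dual_le_refl dual_le_anti dual_le_trans.

Lemma dual_leE f g : (f <= g) = dual_le f g. Proof. by []. Qed.

Let S h x := [set h y | y in [set y | 0 <= y <= x]].
Let q h x := sup (S h x).

Let S_has_sup h x : 0 <= x -> has_sup (S h x).
Proof.
move=> x0; split; first by exists (h 0), 0 => //=; rewrite lexx.
exists (`|h| * `|x|) => _ [y /= /andP[y0 yx] <-].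
rewrite (le_trans (ler_norm _))// (le_trans (op_normP _ _))// ler_wpM2l ?op_norm_ge0//.
exact: ge0_norm_le.
Qed.

Let q_ge h x y : 0 <= y -> y <= x -> h y <= q h x.
Proof.
move=> y0 yx; apply: ub_le_sup; last by exists y => //=; rewrite y0.
exact: (S_has_sup h (le_trans y0 yx)).2.
Qed.

Let q_le h x r : 0 <= x -> (forall y, 0 <= y -> y <= x -> h y <= r) ->
  q h x <= r.
Proof.
move=> x0 hr; apply: ge_sup; first exact: (S_has_sup h x0).1.
by move=> _ [y /= /andP[y0 yx] <-]; exact: hr.
Qed.

Let q_ge0 h x : 0 <= x -> 0 <= q h x.
Proof. by move=> x0; rewrite -(linear0 h) q_ge. Qed.

Let q_bound h x : 0 <= x -> q h x <= `|h| * `|x|.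
Proof.
move=> x0; apply: q_le => // y y0 yx.
rewrite (le_trans (ler_norm _))// (le_trans (op_normP _ _))// ler_wpM2l ?op_norm_ge0//.
exact: ge0_norm_le.
Qed.

Let qD h x y : 0 <= x -> 0 <= y -> q h (x + y) = q h x + q h y.
Proof.
move=> x0 y0; apply/eqP; rewrite eq_le; apply/andP; split.
  apply: q_le => [|z z0 zxy]; first exact: addv_ge0.
  have [z1 [z2 [-> /andP[? ?] /andP[? ?]]]] := riesz_decomposition x0 y0 z0 zxy.
  by rewrite linearD lerD// q_ge.
rewrite -lerBrDr; apply: q_le => // z1 z10 z1x.
rewrite lerBrDr -lerBrDl; apply: q_le => // z2 z20 z2y.
by rewrite lerBrDl -linearD q_ge// ?addv_ge0// lev_add.
Qed.

Let qZ h a x : 0 <= a -> 0 <= x -> q h (a *: x) = a * q h x.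
Proof.
rewrite le_eqVlt => /predU1P[<- x0|].
  rewrite scale0r mul0r; apply/eqP; rewrite eq_le q_ge0// andbT.
  by rewrite (le_trans (q_bound _ _))// normr0 mulr0.
move=> a0 x0.
have le b y : 0 < b -> 0 <= y -> b * q h y <= q h (b *: y).
  move=> b0 y0; rewrite -ler_pdivlMl//; apply: q_le => // z z0 zy.
  rewrite ler_pdivlMl//.
  have -> : b * h z = h (b *: z) by rewrite linearZ.
  apply: q_ge; first by rewrite scalev_ge0// ltW.
  by rewrite -subv_ge0 -scalerBr scalev_ge0 ?subv_ge0// ltW.
apply/eqP; rewrite eq_le le// andbT -ler_pdivrMl//.
rewrite -[in leRHS](scalerK (lt0r_neq0 a0) x) le ?invr_gt0//.
by rewrite scalev_ge0// ltW.
Qed.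

Let Q h x : R := q h (labs x + x) - q h (labs x).

Let QE h u v : 0 <= u -> 0 <= v -> Q h (u - v) = q h u - q h v.
Proof.
move=> u0 v0; set w := u - v; apply/eqP.
rewrite subr_eq addrAC eq_sym subr_eq eq_sym -!qD ?labs_ge0//.
by rewrite -addrA /w subrK addrC.
Qed.

Let Q_linear h : linear (Q h : E -> R^o).
Proof.
have QN x : Q h (- x) = - Q h x.
  by rewrite {1}(decomp x) opprB QE ?labs_ge0// /Q opprB.
have QZ0 a x : 0 <= a -> Q h (a *: x) = a * Q h x.
  move=> a0; rewrite {1}(decomp x) scalerBr QE ?scalev_ge0 ?labs_ge0//.
  by rewrite !qZ ?labs_ge0// -mulrBr.
have QZ a x : Q h (a *: x) = a * Q h x.
  have [a0|a0] := leP 0 a; first exact: QZ0.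
  by rewrite -[a]opprK scaleNr QN QZ0 ?mulNr// oppr_ge0 ltW.
have QD x y : Q h (x + y) = Q h x + Q h y.
  rewrite {1}(decomp x) {1}(decomp y) addrACA -opprD.
  have [x0 y0] := (labsD_ge0 x, labsD_ge0 y).
  have [lx0 ly0] := (labs_ge0 x, labs_ge0 y).
  rewrite (QE _ (addv_ge0 x0 y0) (addv_ge0 lx0 ly0)) (qD _ x0 y0).
  by rewrite (qD _ lx0 ly0) opprD addrACA.
by move=> a x y; rewrite QD QZ.
Qed.

Let Q_continuous h : continuous (Q h : E -> R^o).
Proof.
apply: (@linear_bound_continuous _ _ _ _ (`|h| * 3)) => [|x].
  exact: Q_linear.
rewrite (le_trans (ler_normB _ _))// !ger0_norm ?q_ge0 ?labs_ge0//.
rewrite (le_trans (lerD (q_bound _ _) (q_bound _ _))) ?labs_ge0//.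
rewrite -mulrDr -mulrA ler_wpM2l//.
rewrite norm_labs (le_trans (lerD (ler_normD _ _) (lexx _)))// norm_labs.
by rewrite mulr_natl mulrSr mulr2n.
Qed.

Definition dual_pos h : dual E := 
  BoundedOp (conj (@Q_linear h) (@Q_continuous h)).

Lemma dual_posE h x : 0 <= x ->
  dual_pos h x = sup [set h y | y in [set y | 0 <= y <= x]].
Proof.
move=> x0; rewrite /= -[x in LHS]subr0 QE// -/(q h x).
have /eqP : q h (0 + 0) = q h 0 + q h 0 by rewrite qD.
by rewrite addr0 -subr_eq subrr => /eqP <-; rewrite subr0.
Qed.

Lemma dual_pos_le h k : (dual_pos h <= k) = (h <= k) && (0 <= k).
Proof.
apply/dual_leP/andP => [hk|[/dual_leP hk /dual_leP k0] x x0].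
  split; apply/dual_leP => x x0; apply: le_trans (hk _ x0);
    rewrite dual_posE//; [exact: q_ge|exact: q_ge0].
rewrite dual_posE//; apply: q_le => // y y0 yx; rewrite (le_trans (hk _ y0))//.
by rewrite -subr_ge0 -linearB; apply: k0; rewrite subv_ge0.
Qed.

Let dual_le_add2r h f g : f <= g -> f + h <= g + h.
Proof.
by move=> /dual_leP fg; apply/dual_leP => x x0; rewrite lerD2r fg.
Qed.

Let dual_lerDr f g h : (f <= g + h) = (f - h <= g).
Proof.
apply/idP/idP => [/(dual_le_add2r (- h))|/(dual_le_add2r h)].
  by rewrite addrK.
by rewrite subrK.
Qed.

Definition dual_join f g : dual E := g + dual_pos (f - g).
Definition dual_meet f g : dual E := f - dual_pos (f - g).

Let dual_joinP f g h : (dual_join f g <= h) = (f <= h) && (g <= h).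
Proof.
have -> : (dual_join f g <= h) = (dual_pos (f - g) <= h - g).
  by rewrite dual_lerDr opprK [_ + g]addrC.
by rewrite dual_pos_le !dual_lerDr !opprK subrK add0r.
Qed.

Let dual_meetP f g h : (f <= dual_meet g h) = (f <= g) && (f <= h).
Proof.
have -> : (f <= dual_meet g h) = (dual_pos (g - h) <= g - f).
  by rewrite /dual_meet !dual_lerDr !opprK addrC.
rewrite dual_pos_le andbC !dual_lerDr !opprK add0r; congr (_ && _).
by rewrite addrC -(opprB h g) -dual_lerDr addrC subrK.
Qed.

HB.instance Definition _ :=
  Order.POrder_MeetJoin_isLattice.Build ring_display (dual E)
    dual_meetP dual_joinP.

End dual_lattice.
Section dual_banach_lattice.
Context {R : realType} {E : banachLatticeType R}.
Implicit Types (f g h : dual E) (x y w : E) (a : R).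

Lemma dual_joinE f g : (f `|` g)%O = g + dual_pos (f - g). Proof. by []. Qed.

Let dual_le_add2r (h f g : dual E) : dual_le f g -> dual_le (f + h) (g + h).
Proof.
by move=> /dual_leP fg; apply/dual_leP => x x0; rewrite lerD2r fg.
Qed.

Let dual_scale_ge0 (a : R) f : 0 <= a -> dual_le 0 f -> dual_le 0 (a *: f).
Proof.
move=> a0 /dual_leP f0; apply/dual_leP => x x0.
by rewrite boundedOpZE mulr_ge0// -(boundedOp0E x) f0.
Qed.

Let norm_apply_labs f x : `|f x| <= (f `|` - f)%O (labs x).
Proof.
set F := (f `|` - f)%O.
have fF y : 0 <= y -> `|f y| <= F y.
  move=> y0; rewrite ler_norml lerNl; apply/andP; split.
    by have /dual_leP/(_ y y0) : - f <= F by exact: leUr.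
  by have /dual_leP/(_ y y0) : f <= F by exact: leUl.
pose u := 2^-1 *: (labs x + x); pose v := 2^-1 *: (labs x - x).
have u0 : 0 <= u.
  by rewrite scalev_ge0 ?invr_ge0// -[X in _ + X]opprK subv_ge0 labs_geN.
have v0 : 0 <= v by rewrite scalev_ge0 ?invr_ge0// subv_ge0 labs_ge.
have xE : x = u - v.
  by rewrite -scalerBr opprB addrC addrA subrK scale2_half.
have lxE : labs x = u + v by rewrite -scalerDr addrACA subrr addr0 scale2_half.
rewrite [in leLHS]xE lxE linearB linearD/= (le_trans (ler_normB _ _))//.
by rewrite lerD ?fF.
Qed.

Let apply_labs_le g w : 0 <= w -> (g `|` - g)%O w <= `|g| * `|w|.
Proof.
move=> w0; rewrite dual_joinE opprK boundedOpDE dual_posE//.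
rewrite boundedOpNE addrC lerBlDr; apply: ge_sup.
  by exists ((g + g) 0), 0 => //=; rewrite lexx.
move=> _ [y /= /andP[y0 yw] <-]; rewrite -lerBlDr.
have -> : (g + g) y - g w = g (y + y - w) by rewrite linearB linearD.
rewrite (le_trans (ler_norm _))// (le_trans (op_normP _ _))//.
rewrite ler_wpM2l ?op_norm_ge0// labs_le_norm// (ge0_labs w0).
apply: labs_le.
  by rewrite -[leRHS](addrK w) lev_add2r// lev_add.
by rewrite opprB -subv_ge0 opprB addrCA subrr addr0 addv_ge0.
Qed.

Let dual_le_norm f g :
  dual_le (f `|` - f)%O (g `|` - g)%O -> `|f| <= `|g|.
Proof.
move=> /dual_leP fg; apply: op_norm_le => [|x]; first exact: op_norm_ge0.
rewrite (le_trans (norm_apply_labs f x))// (le_trans (fg _ (labs_ge0 x)))//.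
by rewrite (le_trans (apply_labs_le _ (labs_ge0 x)))// norm_labs.
Qed.

HB.instance Definition _ := isBanachLattice.Build R (dual E)
  (@le_refl _ (dual E)) (@le_anti _ (dual E)) (@le_trans _ (dual E))
  (@lexI _ (dual E)) (fun f g h => leUx f g h)
  dual_le_add2r dual_scale_ge0 dual_le_norm.

End dual_banach_lattice.


Section adjoint.
Context {R : realType} {E F : normedModType R}.
Variable T : boundedOp E F.
Implicit Types f : dual F.

Let comp_linear f : linear (f \o T : E -> R^o).
Proof. by move=> a x y /=; rewrite !linearP. Qed.

Let comp_continuous f : continuous (f \o T : E -> R^o).
Proof.
by move=> x; apply: continuous_comp; exact: boundedOp_continuous.
Qed.

Definition dual_comp f : dual E :=
  BoundedOp (conj (@comp_linear f) (@comp_continuous f)).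

Let dual_comp_linear : linear dual_comp.
Proof. by move=> a f g; apply/boundedOp_eqP. Qed.

Let dual_comp_continuous : continuous dual_comp.
Proof.
apply: (@linear_bound_continuous _ _ _ _ `|T|) => // f.
apply: op_norm_le => [|x]; first by rewrite mulr_ge0 ?op_norm_ge0.
rewrite (le_trans (op_normP f (T x)))// [`|T| * _]mulrC -mulrA.
by rewrite ler_wpM2l ?op_norm_ge0// op_normP.
Qed.

Definition adjoint : boundedOp (dual F) (dual E) :=
  BoundedOp (conj dual_comp_linear dual_comp_continuous).

Lemma adjointE f x : adjoint f x = f (T x). Proof. by []. Qed.

End adjoint.


Section weak_sequences.
Context {R : realType} {Z : normedModType R}.
Implicit Type x : nat -> Z.

Definition norm_null x := x @ \oo --> (0 : Z).

Definition weakly_null x :=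
  forall f : dual Z, (fun n => f (x n) : R) @ \oo --> (0 : R).

Definition weakly_summable (p : R) x :=
  forall f : dual Z, cvgn (series (fun n => `|f (x n) : R| `^ p)).

End weak_sequences.

Section banach_lattice_properties.
Context {R : realType}.
Implicit Type p : R.

Definition disjoint_seq (E : banachLatticeType R) (x : nat -> E) :=
  forall n m, n != m -> (labs (x n) `&` labs (x m))%O = 0.

(** Every net decreasing to [0] (i.e. decreasing with infimum [0]) is norm
    null. The index set of a net is a nonempty directed preordered set. *)
Definition order_continuous_norm (E : banachLatticeType R) :=
  forall (I : Type) (leI : I -> I -> Prop) (x : I -> E),
    inhabited I ->
    (forall i, leI i i) ->
    (forall i j k, leI i j -> leI j k -> leI i k) ->
    (forall i j, exists k, leI i k /\ leI j k) ->
    (forall i j, leI i j -> x j <= x i) ->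
    (forall i, 0 <= x i) ->
    (forall z, (forall i, z <= x i) -> z <= 0) ->
  forall e : R, 0 < e -> exists i, forall j, leI i j -> `|x j| < e.

Definition positive_schur p (E : banachLatticeType R) :=
  forall x : nat -> E,
    (forall n, 0 <= x n) -> weakly_summable p x -> norm_null x.

Definition positive_op (E F : banachLatticeType R) (T : boundedOp E F) :=
  forall x : E, 0 <= x -> 0 <= T x.

Definition disjoint_convergent p (E : banachLatticeType R)
    (Z : completeNormedModType R) (T : boundedOp E Z) :=
  forall x : nat -> E,
    disjoint_seq x -> weakly_summable p x -> norm_null (fun n => T (x n)).

Definition almost_weak_convergent p (E F : banachLatticeType R)
    (T : boundedOp E F) :=
  forall (x : nat -> E) (y : nat -> dual F),
    weakly_null x -> disjoint_seq y -> weakly_summable p y ->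
  (fun n => y n (T (x n)) : R) @ \oo --> (0 : R).

End banach_lattice_properties.

(* Main.v *)
Require Import Defs.
From mathcomp Require Import all_boot all_order all_algebra.
From mathcomp Require Import boolp classical_sets functions.
From mathcomp Require Import reals topology normedtype sequences exp.
From mathcomp Require Import lra.

Set Implicit Arguments.
Unset Strict Implicit.
Unset Printing Implicit Defensive.

Import Order.TTheory GRing.Theory Num.Theory.
Import numFieldNormedType.Exports.

Local Open Scope classical_set_scope.
Local Open Scope ring_scope.

(** If [y] is disjoint weakly p-summable in [F*] then so is [labs y]
    ([disjoint_weakly_summable_labs]), so when [T] is positive only positive
    [y] matter for the convergence of [T* y]. If [F*] has the positive Schur
    property, these [y] are norm null. If [E*] has order continuous norm,
    [T* y] is a weak* null sequence of positive functionals on [E]; when it is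
    not norm null, the Dodds-Fremlin disjointification ([dodds_fremlin])
    produces a disjoint bounded sequence [v] in [E] on which a subsequence of
    [T* y] stays away from [0]. Order continuity of [E*] makes [v] weakly null
    ([oc_dual_disjoint_weakly_null]), so [T] is not almost weak p-convergent.

    Conversely, if [T* y] is norm null for all disjoint weakly p-summable [y],
    then [T* y] also vanishes in the limit along weakly null sequences, since
    these are bounded.

    It remains to build a bad operator when both alternatives fail. In [F*]
    choose a positive, weakly p-summable sequence that is not norm null. By
    [dodds_fremlin] a subsequence [y] stays away from [0] on a disjoint bounded
    sequence [v] of [F]; cutting each [y k] down to its component along [v k]
    gives a disjoint weakly p-summable sequence [f] with [f k (v k)] still
    bounded below ([not_positive_schur]). In [E*] choose positive [w k] with
    order bounded partial sums that are not norm null; they exist because order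
    continuity fails ([order_continuous_criterion]). The operator
    [T x = \sum_k w k x *: v k] factors through l^1, and the Schur property of
    l^1 ([schur]) makes [T] map weakly null sequences to norm null ones; but
    [T* (f k)] dominates a fixed multiple of [w k].

    Disjoint functionals are obtained throughout from components: the component
    of a positive [f] along a cone [A] of positive vectors is
    [x |-> sup_(a in A) f (x `&` a)]. It agrees with [f] on [A], vanishes on
    what is disjoint from [A], and components along disjoint cones are
    disjoint. *)

(** * Riesz space identities *)

Definition vpos (R : realType) (X : banachLatticeType R) (x : X) : X :=
  (x `|` 0)%O.

Section riesz_space.
Context {R : realType} {X : banachLatticeType R}.
Implicit Types (x y z u v w : X) (t : R).

Lemma levBlDr x y z : (x - y <= z) = (x <= z + y).
Proof.
by apply/idP/idP => [/(lev_add2r y)|/(lev_add2r (- y))];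
  rewrite ?subrK ?addrK.
Qed.

Lemma levBrDr x y z : (x <= z - y) = (x + y <= z).
Proof. by rewrite -levBlDr opprK. Qed.

Lemma levN2 x y : (- x <= - y) = (y <= x).
Proof. by apply/idP/idP => /lev_opp; rewrite ?opprK. Qed.

Lemma levDl x y : 0 <= y -> x <= x + y.
Proof. by move=> y0; rewrite -subv_ge0 addrC addrA addNr add0r. Qed.

Lemma levBl x y : 0 <= y -> x - y <= x.
Proof. by move=> y0; rewrite levBlDr levDl. Qed.

Lemma lev_scale t x y : 0 <= t -> x <= y -> t *: x <= t *: y.
Proof. by move=> t0 xy; rewrite -subv_ge0 -scalerBr scalev_ge0// subv_ge0. Qed.

Lemma lev_scalel (a b : R) x : 0 <= x -> a <= b -> a *: x <= b *: x.
Proof. by move=> x0 ab; rewrite -subv_ge0 -scalerBl scalev_ge0// subr_ge0. Qed.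

Lemma sumv_ge0 (I : Type) (r : seq I) (P : pred I) (F : I -> X) :
  (forall i, P i -> 0 <= F i) -> 0 <= \sum_(i <- r | P i) F i.
Proof. by move=> F0; elim/big_ind : _ => //; exact: addv_ge0. Qed.

Lemma meetvDr x y z : ((x + z) `&` (y + z))%O = (x `&` y)%O + z.
Proof.
apply/eqP; rewrite eq_le lexI !lev_add2r ?leIl ?leIr// andbT.
by rewrite -levBlDr lexI !levBlDr leIl leIr.
Qed.

Lemma joinvDr x y z : ((x + z) `|` (y + z))%O = (x `|` y)%O + z.
Proof.
apply/eqP; rewrite eq_le leUx !lev_add2r ?leUl ?leUr//=.
by rewrite -levBrDr leUx !levBrDr leUl leUr.
Qed.

Lemma oppv_meet x y : - (x `&` y)%O = (- x `|` - y)%O.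
Proof.
apply/eqP; rewrite eq_le leUx !levN2 leIl leIr !andbT.
rewrite -[leRHS]opprK levN2 lexI.
by rewrite -[leRHS]opprK levN2 leUl -[leRHS]opprK levN2 leUr.
Qed.

Lemma meetvZ t x y : 0 <= t ->
  ((t *: x) `&` (t *: y))%O = t *: (x `&` y)%O.
Proof.
rewrite le_eqVlt => /predU1P[<-|t0]; first by rewrite !scale0r meetxx.
have t0' := ltW t0; have ti0 : 0 <= t^-1 by rewrite invr_ge0.
apply/eqP; rewrite eq_le lexI !lev_scale ?leIl ?leIr// andbT.
have le z : z <= t *: x -> z <= t *: y -> z <= t *: (x `&` y)%O.
  move=> zx zy; rewrite -[z](scalerKV (lt0r_neq0 t0)) lev_scale// lexI.
  by rewrite -[x in _ <= x](scalerK (lt0r_neq0 t0)) lev_scale//=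
     -[y in _ <= y](scalerK (lt0r_neq0 t0)) lev_scale.
by rewrite le ?leIl ?leIr.
Qed.

(** Because [w + _] distributes over meets, the right-hand side is the meet of
    [x + y], [x + u], [y + u] and [u + u], each of which dominates the left. *)
Lemma meetv_addl_le x y u : 0 <= x -> 0 <= y -> 0 <= u ->
  ((x + y) `&` u)%O <= (x `&` u)%O + (y `&` u)%O.
Proof.
move=> x0 y0 u0; have yu0 : 0 <= (y `&` u)%O by rewrite lexI y0.
rewrite -meetvDr lexI; apply/andP; split; last first.
  by rewrite (le_trans (leIr _ _))// levDl.
rewrite [x + (_ `&` _)%O]addrC -meetvDr lexI [y + x]addrC leIl/=.
by rewrite (le_trans (leIr _ _))// levDl.
Qed.

Lemma disjoint_le x y u v : 0 <= x -> x <= u -> 0 <= y -> y <= v ->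
  (u `&` v)%O = 0 -> (x `&` y)%O = 0.
Proof.
move=> x0 xu y0 yv uv; apply/eqP; rewrite eq_le lexI x0 y0 !andbT.
by rewrite -uv leI2.
Qed.

Lemma disjoint_addv x y u : 0 <= x -> 0 <= y -> 0 <= u ->
  (x `&` u)%O = 0 -> (y `&` u)%O = 0 -> ((x + y) `&` u)%O = 0.
Proof.
move=> x0 y0 u0 xu yu; apply/eqP; rewrite eq_le lexI addv_ge0// u0 !andbT.
by rewrite (le_trans (meetv_addl_le _ _ _))// xu yu addr0.
Qed.

Lemma disjoint_scalev t x u : 0 <= t -> 0 <= x -> 0 <= u ->
  (x `&` u)%O = 0 -> ((t *: x) `&` u)%O = 0.
Proof.
move=> t0 x0 u0 xu; have t1 : 1 <= 1 + t by rewrite lerDl.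
apply: (@disjoint_le _ _ ((1 + t) *: x) ((1 + t) *: u)) => //.
- exact: scalev_ge0.
- by rewrite scalerDl addrC levDl// scale1r.
- by rewrite scalerDl scale1r levDl// scalev_ge0.
- by rewrite meetvZ ?xu ?scaler0// addr_ge0.
Qed.

Lemma disjoint_addv_le x y z : (x `&` y)%O = 0 -> x <= z -> y <= z ->
  x + y <= z.
Proof.
move=> xy xz yz; rewrite -[z]add0r -levBlDr -xy lexI.
by rewrite !levBlDr lev_add// [x + y]addrC lev_add.
Qed.

Lemma vpos_ge0 x : 0 <= vpos x. Proof. by rewrite /vpos leUr. Qed.
Lemma vpos_ge x : x <= vpos x. Proof. by rewrite /vpos leUl. Qed.
Lemma vpos_le x y : 0 <= y -> x <= y -> vpos x <= y.
Proof. by move=> y0 xy; rewrite /vpos leUx xy. Qed.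
Lemma le_vpos x y : x <= y -> vpos x <= vpos y.
Proof. by move=> xy; rewrite leU2. Qed.

Lemma vpos_subN x : x = vpos x - vpos (- x).
Proof.
have -> : vpos (- x) = vpos x - x.
  by rewrite /vpos -joinvDr subrr add0r joinC.
by rewrite opprB addrC subrK.
Qed.

Lemma disjoint_vpos x : (vpos x `&` vpos (- x))%O = 0.
Proof.
have e : vpos x = x + vpos (- x) by rewrite {2}(vpos_subN x) subrK.
rewrite e -{2}[vpos (- x)]add0r meetvDr -[(x `&` 0)%O]opprK oppv_meet oppr0.
by rewrite addNr.
Qed.

Lemma labs_vpos x : labs x = vpos x + vpos (- x).
Proof.
apply/eqP; rewrite eq_le; apply/andP; split.
  apply: labs_le.
    by rewrite (le_trans (vpos_ge x))// levDl// vpos_ge0.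
  by rewrite (le_trans (vpos_ge (- x)))// addrC levDl// vpos_ge0.
by apply: disjoint_addv_le;
  rewrite ?disjoint_vpos ?vpos_le ?labs_ge0 ?labs_ge ?labs_geN.
Qed.

Lemma vpos_le_labs x : vpos x <= labs x.
Proof. by rewrite vpos_le ?labs_ge0 ?labs_ge. Qed.

Lemma vposN_le_labs x : vpos (- x) <= labs x.
Proof. by rewrite vpos_le ?labs_ge0 ?labs_geN. Qed.

Lemma norm_vpos_le x y : vpos x <= labs y -> `|vpos x| <= `|y|.
Proof.
by move=> xy; rewrite -(norm_labs y) ge0_norm_le// vpos_ge0.
Qed.

(** If [y] is nonnegative, the negative part of [x] is at most [labs (x - y)],
    so it has norm at most [`|x - y|]. *)
Lemma closed_cone x : (forall e : R, 0 < e ->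
  exists2 y, 0 <= y & `|x - y| < e) -> 0 <= x.
Proof.
move=> xy; suff x0 : vpos (- x) = 0 by rewrite (vpos_subN x) x0 subr0 vpos_ge0.
apply/eqP; rewrite -normr_le0; apply/ler_addgt0Pl => e /xy[y y0 xye].
rewrite addr0 (le_trans _ (ltW xye))//; apply: norm_vpos_le.
apply: vpos_le; first exact: labs_ge0.
by rewrite (le_trans _ (labs_geN _))// levN2 levBl.
Qed.

(** The two vectors are the positive part, and up to the factor [t^-1] the
    negative part, of [x - t *: y]. *)
Lemma vpos_scale_disjoint x y t : 0 < t ->
  (vpos (x - t *: y) `&` vpos (y - t^-1 *: x))%O = 0.
Proof.
move=> t0; set w := x - t *: y.
have -> : y - t^-1 *: x = t^-1 *: (- w).
  by rewrite opprB scalerBr scalerK ?gt_eqF.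
have ti0 : 0 <= t^-1 by rewrite invr_ge0 ltW.
rewrite meetC; apply: (@disjoint_le _ _ (t^-1 *: vpos (- w)) (vpos w)) => //.
- exact: vpos_ge0.
- by rewrite vpos_le ?scalev_ge0 ?vpos_ge0// lev_scale// vpos_ge.
- exact: vpos_ge0.
- by rewrite disjoint_scalev ?vpos_ge0// meetC disjoint_vpos.
Qed.

End riesz_space.

(** * Making a sequence disjoint *)

Section disjoint_sequences.
Context {R : realType} {X : banachLatticeType R}.
Implicit Types (x z b : nat -> X) (s : X).

Lemma disjoint_seq_ge0 z : (forall n, 0 <= z n) ->
  (forall n m, (n < m)%N -> (z n `&` z m)%O = 0) -> disjoint_seq z.
Proof.
move=> z0 zd n m; rewrite !ge0_labs//.
by rewrite neq_ltn => /orP[|] /zd//; rewrite meetC.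
Qed.

(** For [j < k], subtracting [b k] removes [4 ^+ k *: x j] from [x k], while
    subtracting a multiple of [s] removes at least [4 ^- k *: x k] from [x j].
    What is left is dominated by the positive and negative parts of one vector
    up to scaling. *)
Lemma disjointify x b s : (forall k, 0 <= x k) -> (forall k, 0 <= b k) ->
  0 <= s -> (forall j k, (j < k)%N -> 4 ^+ k *: x j <= b k) ->
  (forall k, 2^-1 ^+ k *: x k <= s) ->
  disjoint_seq (fun k => vpos (x k - b k - 2^-1 ^+ k *: s)).
Proof.
move=> x0 b0 s0 xb xs; apply: disjoint_seq_ge0 => [n|j k jk].
  exact: vpos_ge0.
have p2 n : (0 : R) <= 2^-1 ^+ n by rewrite exprn_ge0// invr_ge0.
have p4 : (0 : R) < 4 ^+ k by rewrite exprn_gt0.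
rewrite meetC; apply: (@disjoint_le _ _ _ _ (vpos (x k - 4 ^+ k *: x j))
   (vpos (x j - (4 ^+ k)^-1 *: x k))); try exact: vpos_ge0.
- apply: le_vpos; rewrite (le_trans (levBl _ _)) ?scalev_ge0//.
  by apply: lev_add => //; rewrite levN2 xb.
- apply: le_vpos; rewrite -addrA -opprD; apply: lev_add => //; rewrite levN2.
  rewrite (@le_trans _ _ (2^-1 ^+ j *: s))//; last by rewrite addrC levDl.
  rewrite (@le_trans _ _ (2^-1 ^+ j *: (2^-1 ^+ k *: x k)))//; last first.
    exact: lev_scale.
  rewrite scalerA lev_scalel// -exprVn (_ : 4^-1 = 2^-1 * 2^-1); last by lra.
  by rewrite exprMn ler_wpM2r// ler_wiXn2l ?invr_ge0 ?invf_le1 ?ler1n// ltnW.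
- exact: vpos_scale_disjoint.
Qed.

End disjoint_sequences.

(** * Functionals and their components *)

Section functionals.
Context {R : realType} {X : banachLatticeType R}.
Implicit Types (f g h : dual X) (x y : X).

Lemma dual_lev f g x : f <= g -> 0 <= x -> f x <= g x.
Proof. by move=> /dual_leP fg x0; exact: fg. Qed.

Lemma dual_ge0P f : (0 <= f) <-> (forall x, 0 <= x -> 0 <= f x).
Proof. by split=> [f0 x x0|f0]; [exact: (dual_lev f0)|apply/dual_leP]. Qed.

Lemma dual_apply_ge0 f x : 0 <= f -> 0 <= x -> 0 <= f x.
Proof. by move=> /dual_ge0P; exact. Qed.

Lemma dual_homo f x y : 0 <= f -> x <= y -> f x <= f y.
Proof.
by move=> f0 xy; rewrite -subr_ge0 -linearB dual_apply_ge0// subv_ge0.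
Qed.

Lemma dual_norm_le f x : 0 <= f -> `|f x| <= f (labs x).
Proof.
move=> f0; rewrite ler_norml -linearN !dual_homo ?labs_ge//.
by rewrite -levN2 opprK labs_geN.
Qed.

Lemma dual_labs_le f x : 0 <= x -> `|f x| <= labs f x.
Proof.
move=> x0; rewrite ler_norml lerNl; apply/andP; split.
  exact: (dual_lev (labs_geN f) x0).
exact: (dual_lev (labs_ge f) x0).
Qed.

(** The extension is [x |-> q (vpos x) - q (vpos (- x))]; additivity on the cone
    makes [q u - q v] depend only on [u - v], which gives linearity. *)
Lemma cone_extension (q : X -> R) (C : R) :
  (forall x, 0 <= x -> 0 <= q x) ->
  (forall x, 0 <= x -> q x <= C * `|x|) ->
  (forall x y, 0 <= x -> 0 <= y -> q (x + y) = q x + q y) ->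
  (forall a x, 0 <= a -> 0 <= x -> q (a *: x) = a * q x) ->
  exists g : dual X, forall x, 0 <= x -> g x = q x.
Proof.
move=> q0 qC qD qZ.
pose Q x : R^o := q (vpos x) - q (vpos (- x)).
have QE u v : 0 <= u -> 0 <= v -> Q (u - v) = q u - q v.
  move=> u0 v0; have : vpos (u - v) + v = vpos (- (u - v)) + u.
    rewrite -[X in X + v](subrK (vpos (- (u - v)))) -vpos_subN.
    by rewrite addrAC subrK addrC.
  by move=> /(congr1 q); rewrite !qD ?vpos_ge0// /Q; lra.
have QN x : Q (- x) = - Q x by rewrite /Q opprK opprB.
have QZ0 a x : 0 <= a -> Q (a *: x) = a * Q x.
  move=> a0; rewrite {1}(vpos_subN x) scalerBr QE ?scalev_ge0 ?vpos_ge0//.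
  by rewrite !qZ ?vpos_ge0// -mulrBr.
have Ql : linear Q.
  have QD x y : Q (x + y) = Q x + Q y.
    rewrite {1}(vpos_subN x) {1}(vpos_subN y) addrACA -opprD.
    by rewrite QE ?addv_ge0 ?vpos_ge0// !qD ?vpos_ge0// opprD addrACA.
  move=> a x y; rewrite QD; congr (_ + _).
  have [a0|a0] := leP 0 a; first exact: QZ0.
  by rewrite -[a in LHS]opprK scaleNr QN QZ0 ?mulNr ?opprK// oppr_ge0 ltW.
have Qc : continuous Q.
  apply: (@linear_bound_continuous _ _ _ _ (C + C)) => // x.
  rewrite (le_trans (ler_normB _ _))// !ger0_norm ?q0 ?vpos_ge0// mulrDl.
  have le y : vpos y <= labs x -> q (vpos y) <= C * `|x|.
    move=> yx; have := qC _ (labs_ge0 x); rewrite norm_labs; apply: le_trans.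
    rewrite -[labs x](subrK (vpos y)) qD ?vpos_ge0 ?subv_ge0// lerDr.
    by rewrite q0 ?subv_ge0.
  by rewrite lerD// le ?vpos_le_labs ?vposN_le_labs.
exists (BoundedOp (conj Ql Qc)) => x x0 /=.
have := QE x 0 x0 (lexx 0); rewrite subr0 => ->.
by rewrite -(scale0r 0) qZ// mul0r subr0.
Qed.

End functionals.

Definition positive_cone (R : realType) (X : banachLatticeType R)
    (A : set X) :=
  [/\ A 0, forall a, A a -> 0 <= a,
      forall a b, A a -> A b -> A (a + b) &
      forall (t : R) a, 0 <= t -> A a -> A (t *: a)].

(** By [componentE] the set of such [g] is nonempty when [A] is a positive cone
    and [f] is positive. The component is then the least positive functional
    that agrees with [f] on all positive vectors dominated by elements of [A]. *)
Definition component (R : realType) (X : banachLatticeType R) (A : set X)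
    (f : dual X) : dual X :=
  xget 0 [set g : dual X | forall x, 0 <= x ->
    g x = sup [set f (x `&` a)%O | a in A]].

Section component.
Context {R : realType} {X : banachLatticeType R}.
Implicit Types (f g h : dual X) (x y a b : X) (A B : set X).

Let s f A x : R := sup [set f (x `&` a)%O | a in A].

Let s_has_sup f A x : 0 <= f -> positive_cone A -> 0 <= x ->
  has_sup [set f (x `&` a)%O | a in A].
Proof.
move=> f0 [A0 _ _ _] x0; split; first by exists (f (x `&` 0)%O), 0.
by exists (f x) => _ [a Aa <-]; rewrite dual_homo// leIl.
Qed.

Let s_ge f A x a : 0 <= f -> positive_cone A -> 0 <= x -> A a ->
  f (x `&` a)%O <= s f A x.
Proof.
move=> f0 cA x0 Aa; apply: ub_le_sup; first by have [] := s_has_sup f0 cA x0.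
by exists a.
Qed.

Let s_le f A x (r : R) : positive_cone A -> 0 <= x ->
  (forall a, A a -> f (x `&` a)%O <= r) -> s f A x <= r.
Proof.
move=> [A0 _ _ _] x0 le; apply: ge_sup; first by exists (f (x `&` 0)%O), 0.
by move=> _ [a Aa <-]; exact: le.
Qed.

(** The supremum is additive: [meetv_addl_le] gives one inequality, and
    [x `&` a + y `&` b <= (x + y) `&` (a + b)] the other. *)
Lemma componentE A f x : positive_cone A -> 0 <= f -> 0 <= x ->
  component A f x = sup [set f (x `&` a)%O | a in A].
Proof.
move=> cA f0; move: x; rewrite /component.
suff [g gP] : exists g : dual X, forall x, 0 <= x -> g x = s f A x.
  by case: xgetP => [? _ h x|/(_ g)[]//]; exact: h.
have [A0 Age0 AD AZ] := cA.
apply: (@cone_extension _ _ _ `|f|) => [x x0|x x0|x y x0 y0|t x t0 x0].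
- by rewrite (le_trans _ (s_ge f0 cA x0 A0))// meet_r// linear0.
- apply: s_le => // a Aa; rewrite (le_trans (dual_homo f0 (leIl x a)))//.
  by rewrite (le_trans (ler_norm _))// op_normP.
- apply/eqP; rewrite eq_le; apply/andP; split.
    apply: s_le; rewrite ?addv_ge0// => a Aa.
    have := dual_homo f0 (meetv_addl_le x0 y0 (Age0 _ Aa)).
    by rewrite linearD => /le_trans; apply; rewrite lerD ?s_ge.
  rewrite -lerBrDr; apply: s_le => // a Aa; rewrite lerBrDr -lerBrDl.
  apply: s_le => // b Ab; rewrite lerBrDl -linearD.
  rewrite (le_trans _ (s_ge f0 cA (addv_ge0 x0 y0) (AD _ _ Aa Ab)))//.
  by rewrite dual_homo// lexI !lev_add ?leIl ?leIr.
- move: t0; rewrite le_eqVlt => /predU1P[<-|t0].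
    rewrite scale0r mul0r; apply/eqP; rewrite eq_le s_le//=; last first.
      by move=> a /Age0 a0; rewrite meet_l// linear0.
    by rewrite (le_trans _ (s_ge f0 cA (lexx 0) A0))// meetxx linear0.
  have t1 : 0 <= t^-1 by rewrite invr_ge0 ltW.
  apply/eqP; rewrite eq_le; apply/andP; split.
    apply: s_le; first exact: cA.
      by rewrite scalev_ge0// ltW.
    move=> a Aa; rewrite -[a](scalerKV (lt0r_neq0 t0)) meetvZ ?(ltW t0)//.
    rewrite linearZ/= ler_pM2l// s_ge//; exact: AZ.
  rewrite -ler_pdivlMl//; apply: s_le => // a Aa; rewrite ler_pdivlMl//.
  have -> : t * f (x `&` a)%O = f (t *: (x `&` a)%O) by rewrite linearZ.
  rewrite -meetvZ ?(ltW t0)// s_ge ?scalev_ge0 ?(ltW t0)//.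
  by apply: AZ; rewrite ?(ltW t0).
Qed.

Lemma component_ge A f x a : positive_cone A -> 0 <= f -> 0 <= x -> A a ->
  f (x `&` a)%O <= component A f x.
Proof. by move=> cA f0 x0 Aa; rewrite componentE//; exact: s_ge. Qed.

Lemma component_le A f x (r : R) : positive_cone A -> 0 <= f -> 0 <= x ->
  (forall a, A a -> f (x `&` a)%O <= r) -> component A f x <= r.
Proof. by move=> cA f0 x0 le; rewrite componentE//; exact: s_le. Qed.

Lemma component_ge0 A f : positive_cone A -> 0 <= f -> 0 <= component A f.
Proof.
move=> cA f0; apply/dual_ge0P => x x0; have [A0 _ _ _] := cA.
by rewrite (le_trans _ (component_ge cA f0 x0 A0))// meet_r// linear0.
Qed.

Lemma component_lef A f : positive_cone A -> 0 <= f -> component A f <= f.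
Proof.
move=> cA f0; apply/dual_leP => x x0; apply: component_le => // a Aa.
by rewrite dual_homo// leIl.
Qed.

Lemma component_id A f a : positive_cone A -> 0 <= f -> A a ->
  component A f a = f a.
Proof.
move=> cA f0 Aa; have [_ Age0 _ _] := cA; have a0 := Age0 _ Aa.
apply/eqP; rewrite eq_le (dual_lev (component_lef cA f0))//=.
by rewrite (le_trans _ (component_ge cA f0 a0 Aa))// meetxx.
Qed.

Lemma component_eq0 A f x : positive_cone A -> 0 <= f -> 0 <= x ->
  (forall a, A a -> (x `&` a)%O = 0) -> component A f x = 0.
Proof.
move=> cA f0 x0 xA; apply/eqP; rewrite eq_le dual_apply_ge0 ?component_ge0//.
by rewrite andbT component_le// => a /xA ->; rewrite linear0.
Qed.

Lemma component_subset A B f : positive_cone A -> positive_cone B -> 0 <= f ->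
  A `<=` B -> component A f <= component B f.
Proof.
move=> cA cB f0 AB; apply/dual_leP => x x0; apply: component_le => // a Aa.
by apply: component_ge => //; exact: AB.
Qed.

(** At [x], split [x] into [x `&` a], on which the component along [B]
    vanishes, and the rest, on which the component along [A] becomes small for
    a suitable [a]. *)
Lemma component_disjoint A B f g : positive_cone A -> positive_cone B ->
  0 <= f -> 0 <= g -> (forall a b, A a -> B b -> (a `&` b)%O = 0) ->
  (component A f `&` component B g)%O = 0.
Proof.
move=> cA cB f0 g0 AB; have [_ Age0 _ _] := cA.
set fA := component A f; set gB := component B g.
have fA0 : 0 <= fA by exact: component_ge0.
have gB0 : 0 <= gB by exact: component_ge0.
apply/eqP; rewrite eq_le lexI fA0 gB0 !andbT; apply/dual_leP => x x0.
rewrite boundedOp0E; apply/ler_addgt0Pr => e e0; rewrite add0r.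
suff [a Aa fAa] : exists2 a, A a & fA x - fA (x `&` a)%O <= e.
  have xa0 : 0 <= (x `&` a)%O by rewrite lexI x0 Age0.
  rewrite -[x in leLHS](subrK (x `&` a)%O) linearD (le_trans _ fAa)//.
  rewrite -linearB -[leRHS]addr0 lerD//.
    by rewrite dual_lev ?leIl// subv_ge0 leIl.
  rewrite -(@component_eq0 B g (x `&` a)%O)// ?dual_lev ?leIr// => b Bb.
  by rewrite -meetA (AB _ _ Aa Bb) meet_r.
have [_ [a Aa <-] fxa] := @sup_adherent _ _ _ e0 (s_has_sup f0 cA x0).
exists a => //; rewrite lerBlDr -lerBlDl -componentE// in fxa *.
have xa0 : 0 <= (x `&` a)%O by rewrite lexI x0 Age0.
rewrite (le_trans (ltW fxa))//.
by rewrite (le_trans _ (component_ge cA f0 xa0 Aa))// meetIK.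
Qed.

End component.

Section cones.
Context {R : realType} {X : banachLatticeType R}.
Implicit Types (v : X) (D : set X).

Definition ray v : set X := [set t *: v | t in [set t : R | 0 <= t]].

Definition disjoint_complement D : set X :=
  [set a : X | 0 <= a /\ forall d, D d -> (a `&` d)%O = 0].

Lemma ray_cone v : 0 <= v -> positive_cone (ray v).
Proof.
move=> v0; split.
- by exists 0; rewrite //= scale0r.
- by move=> _ [t /= t0 <-]; rewrite scalev_ge0.
- move=> _ _ [t /= t0 <-] [r /= r0 <-]; exists (t + r) => /=.
    exact: addr_ge0.
  by rewrite scalerDl.
- move=> t _ t0 [r /= r0 <-]; exists (t * r) => /=; first exact: mulr_ge0.
  by rewrite scalerA.
Qed.

Lemma ray_refl v : ray v v.
Proof. by exists 1 => //=; rewrite scale1r. Qed.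

Lemma disjoint_complement_cone D : (forall d, D d -> 0 <= d) ->
  positive_cone (disjoint_complement D).
Proof.
move=> D0; split.
- by split=> // d /D0 d0; rewrite meet_l.
- by move=> a [].
- move=> a b [a0 aD] [b0 bD]; split; first exact: addv_ge0.
  by move=> d Dd; apply: disjoint_addv => //; [exact: D0|exact: aD|exact: bD].
- move=> t a t0 [a0 aD]; split; first exact: scalev_ge0.
  by move=> d Dd; apply: disjoint_scalev => //; [exact: D0|exact: aD].
Qed.

End cones.

(** * Limits *)

Section limits.
Context {R : realType}.

Lemma near_infty_ex (P : nat -> Prop) (N : nat) :
  (\forall n \near \oo, P n) -> exists2 n, (N <= n)%N & P n.
Proof.
move=> [M _ MP]; exists (maxn N M); first exact: leq_maxl.
by apply: MP => /=; exact: leq_maxr.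
Qed.

Lemma not_norm_null (Z : normedModType R) (x : nat -> Z) : ~ norm_null x ->
  exists2 e : R, 0 < e & forall N, exists2 n, (N <= n)%N & e <= `|x n|.
Proof.
move=> xn; apply: contrapT => xe; apply: xn; apply/cvgr0Pnorm_lt => e e0.
apply: contrapT => nxe; apply: xe; exists e => // N.
apply: contrapT => Nxe; apply: nxe; exists N => // n /= Nn.
by rewrite ltNge; apply/negP => en; apply: Nxe; exists n.
Qed.

Context {X : banachLatticeType R}.

Lemma lev_lim (x : nat -> X) (l a : X) : x @ \oo --> l ->
  (\forall n \near \oo, a <= x n) -> a <= l.
Proof.
move=> xl ax; rewrite -subv_ge0; apply: closed_cone => e e0.
have /cvgrPdist_lt/(_ e e0) xe := xl.
have [n _ [axn xne]] := near_infty_ex 0 (filterI ax xe).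
exists (x n - a); first by rewrite subv_ge0.
by rewrite opprB addrA subrK.
Qed.

Lemma series_lev_lim (u : nat -> X) (N : nat) : (forall n, 0 <= u n) ->
  cvgn (series u) -> series u N <= limn (series u).
Proof.
move=> u0 uc; apply: (lev_lim uc); exists N => // n /= Nn.
by rewrite -subv_ge0 sub_series_geq// sumv_ge0.
Qed.

Lemma scaled_bound (y : nat -> X) : (forall n, 0 <= y n) ->
  (forall n, `|y n| <= 1) ->
  exists2 s, 0 <= s & forall n, 2^-1 ^+ n *: y n <= s.
Proof.
move=> y0 y1; pose u n := 2^-1 ^+ n *: y n.
have p2 n : (0 : R) <= 2^-1 ^+ n by rewrite exprn_ge0// invr_ge0.
have u0 n : 0 <= u n by rewrite scalev_ge0.
have uc : cvgn (series u).
  apply: normed_cvg; apply: (@series_le_cvg _ _ (geometric 1 2^-1)) => //= n.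
  - by rewrite mul1r.
  - by rewrite normrZ mul1r ger0_norm// ler_piMr.
  - apply: is_cvg_geometric_series.
    by rewrite ger0_norm ?invr_ge0// invf_lt1// ltr1n.
exists (limn (series u)).
  have := series_lev_lim 0 u0 uc; apply: le_trans.
  by rewrite /series /= big_nat sumv_ge0.
move=> n; apply: (le_trans _ (series_lev_lim n.+1 u0 uc)).
by rewrite /series /= big_nat_recr//= addrC levDl// sumv_ge0.
Qed.

End limits.

(** * Disjoint sequences on which functionals stay large *)

Section dodds_fremlin.
Context {R : realType} {X : banachLatticeType R}.

Lemma half_norm_attained (f : dual X) : 0 <= f ->
  exists x : X, [/\ 0 <= x, `|x| <= 1 & `|f| / 2 <= f x].
Proof.
move=> f0; apply: contrapT => fN.
have fx (x : X) : 0 <= x -> `|x| <= 1 -> f x <= `|f| / 2.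
  move=> x0 x1; rewrite leNgt; apply/negP => fx; apply: fN.
  by exists x; split=> //; exact: ltW.
have n0 : 0 <= `|f| / 2 by rewrite divr_ge0.
have : `|f| <= `|f| / 2.
  apply: op_norm_le => // x; rewrite (le_trans (dual_norm_le x f0))//.
  have [->|x0] := eqVneq x 0.
    by rewrite normr0 mulr0 /labs oppr0 joinxx linear0.
  have nx : 0 < `|x| by rewrite normr_gt0.
  rewrite -ler_pdivrMr// mulrC.
  have -> : `|x|^-1 * f (labs x) = f (`|x|^-1 *: labs x) by rewrite linearZ.
  apply: fx; first by rewrite scalev_ge0 ?labs_ge0// invr_ge0.
  by rewrite normrZ norm_labs ger0_norm ?invr_ge0// mulVf// gt_eqF.
move=> f2; apply: fN; exists 0; rewrite lexx normr0 ler01 linear0; split=> //.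
lra.
Qed.

(** Choose [x n >= 0] of norm at most [1] at which [g n] attains half its norm.
    Since [g] is weak* null, one can pass to a subsequence along which each
    functional is small on the vectors chosen before, even when these are
    multiplied by large constants, and on a fixed vector [z] dominating the
    chosen vectors scaled by powers of [2^-1]. Hence the subtractions made by
    [disjointify] cost little when the functionals are evaluated. *)
Lemma dodds_fremlin (g : nat -> dual X) : (forall n, 0 <= g n) ->
  (forall x, (fun n => g n x : R) @ \oo --> (0 : R)) -> ~ norm_null g ->
  exists (e : R) (s : nat -> nat) (v : nat -> X),
    [/\ 0 < e, {homo s : i j / (i < j)%N},
        forall k, 0 <= v k /\ `|v k| <= 1,
        disjoint_seq v & forall k, e <= g (s k) (v k)].
Proof.
move=> g0 gx /not_norm_null[e e0 ge].
have /choice[x xP] n := half_norm_attained (g0 n).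
(* [b N] also collects terms off the subsequence, so that the next index
   depends on [N] alone and not on the history of the construction. *)
pose b N := 4 ^+ N *: \sum_(i < N) x i.
have b0 N : 0 <= b N.
  by rewrite scalev_ge0 ?exprn_ge0// sumv_ge0// => i _; have [] := xP i.
have /choice[nxt nxtP] N : exists n,
    [/\ (N <= n)%N, e <= `|g n| & g n (b N) <= e / 8].
  have /cvgr0Pnorm_lt/(_ (e / 8)) := gx (b N).
  rewrite divr_gt0// => /(_ isT)[M _ MP].
  have [n nMN en] := ge (maxn N M); move: nMN; rewrite geq_max => /andP[Nn Mn].
  exists n; split=> //; apply: ltW; rewrite (le_lt_trans _ (MP n Mn))//.
  exact: ler_norm.
(* [N k] is one more than the previous index, and [0] at the start. *)
pose N k := iter k (fun n => (nxt n).+1) 0%N.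
pose s k := nxt (N k).
have Ns k : (N k <= s k)%N by have [] := nxtP (N k).
have shomo : {homo s : i j / (i < j)%N}.
  apply: homo_ltn => [? ? ?|k]; first exact: ltn_trans.
  exact: Ns k.+1.
have sge k : (k <= s k)%N.
  by elim: k => // k IH; rewrite (leq_ltn_trans IH)// shomo.
have sN j k : (j < k)%N -> (s j < N k)%N.
  case: k => // k; rewrite ltnS leq_eqVlt => /predU1P[->//|/shomo jk].
  by rewrite ltnS ltnW.
have kN k : (k <= N k)%N.
  by case: k => // k; rewrite ltnS sge.
have [|n|z z0 zs] := @scaled_bound _ _ (x \o s).
- by move=> n; have [] := xP (s n).
- by have [] := xP (s n).
have /cvgr0Pnorm_lt/(_ (e / 8)) := gx z.
rewrite divr_gt0// => /(_ isT)[K _ KP].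
pose v k := vpos (x (s k) - b (N k) - 2^-1 ^+ k *: z).
have vx k : v k <= x (s k).
  have [xk0 _ _] := xP (s k); apply: vpos_le => //.
  rewrite (le_trans (levBl _ _)) ?levBl//.
  by rewrite scalev_ge0// exprn_ge0// invr_ge0.
have vd : disjoint_seq v.
  apply: (@disjointify _ _ (x \o s) (b \o N)) => //=.
    by move=> k; have [] := xP (s k).
  move=> j k jk; rewrite (@le_trans _ _ (4 ^+ k *: \sum_(i < N k) x i))//.
    rewrite lev_scale ?exprn_ge0// (bigD1 (Ordinal (sN _ _ jk)))//=.
    by rewrite levDl// sumv_ge0// => i _; have [] := xP i.
  rewrite lev_scalel//.
    by apply: sumv_ge0 => i _; have [] := xP i.
  by rewrite ler_weXn2l// ler1n.
(* The value [e / 2] on [x (s i)] loses at most [e / 8] to [b (N i)] and, beyond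
   the index [K], at most [e / 8] to [z]. *)
exists (e / 4), (fun k => s (k + K)%N), (fun k => v (k + K)%N); split=> //.
- by rewrite divr_gt0.
- by move=> i j ij; rewrite shomo// ltn_add2r.
- move=> k; split; first exact: vpos_ge0.
  have [_ x1 _] := xP (s (k + K)%N).
  by rewrite (le_trans _ x1)// ge0_norm_le// vpos_ge0.
- by move=> n m nm; apply: vd; rewrite eqn_add2r.
move=> k; set i := (k + K)%N.
have [_ esi gb] := nxtP (N i); rewrite -/(s i) in esi gb.
have [_ _ gx2] := xP (s i).
have gz : g (s i) z <= e / 8.
  apply: ltW; rewrite (le_lt_trans (ler_norm _))// KP//=.
  by rewrite (leq_trans _ (sge i))// leq_addl.
rewrite (@le_trans _ _ (g (s i) (x (s i) - b (N i) - z)))//.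
  by rewrite !linearB/=; lra.
rewrite dual_homo// (le_trans _ (vpos_ge _))// lev_add// levN2.
by rewrite -[leRHS]scale1r lev_scalel// exprn_ile1 ?invr_ge0// invf_le1// ler1n.
Qed.

End dodds_fremlin.

(** * Order continuity of the norm *)

Section order_continuity.
Context {R : realType} {X : banachLatticeType R}.

Lemma archimedean (z u : X) : (forall n, z *+ n <= u) -> z <= 0.
Proof.
move=> zu; rewrite -levN2 oppr0; apply: closed_cone => e e0.
have [n en] : exists n : nat, `|u| / e < n.+1%:R.
  exists (Num.truncn (`|u| / e)); exact: truncnS_gt.
exists (n.+1%:R^-1 *: u - z).
  rewrite subv_ge0 -[z](@scalerK _ _ n.+1%:R) ?pnatr_eq0//.
  by rewrite lev_scale ?invr_ge0// scaler_nat.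
rewrite opprB addrA addNr add0r normrN normrZ ger0_norm ?invr_ge0//.
by rewrite ltr_pdivrMl// mulrC -ltr_pdivrMl// mulrC.
Qed.

(** The infimum of [h] is not available beforehand, but the differences of [h]
    with its lower bounds form a net decreasing to [0]: if [z] lies below all of
    these differences, adding [z] to a lower bound gives a lower bound, so all
    multiples of [z] are at most [h 0]. *)
Lemma oc_decreasing_cauchy (h : nat -> X) : order_continuous_norm X ->
  (forall n, 0 <= h n) -> (forall n, h n.+1 <= h n) ->
  norm_null (fun n => h n - h n.+1).
Proof.
move=> oc h0 hS.
have hmono m n : (m <= n)%N -> h n <= h m.
  move=> /subnK <-; elim: (n - m)%N => // k IH; rewrite addSn.
  exact: le_trans (hS _) IH.
pose L := {l : X | forall n, l <= h n}.
pose leI (i j : nat * L) := (i.1 <= j.1)%N /\ sval i.2 <= sval j.2.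
have l0 : L by exists 0.
have h_l (i : nat * L) : 0 <= h i.1 - sval i.2.
  by case: i => n [l lh]/=; rewrite subv_ge0.
have och e : 0 < e -> exists i, forall j, leI i j ->
    `|h j.1 - sval j.2| < e.
  apply: oc => //.
  - exact: (inhabits (0%N, l0)).
  - move=> i j k [ij1 ij2] [jk1 jk2]; split; first exact: leq_trans jk1.
    exact: le_trans jk2.
  - move=> [m l] [n k].
    have lk : forall n, (sval l `|` sval k)%O <= h n.
      by move=> ?; rewrite leUx (svalP l) (svalP k).
    exists (maxn m n, exist _ _ lk); rewrite /leI /=.
    by rewrite leq_maxl leq_maxr leUl leUr.
  - move=> [m l] [n k] [/= mn lk]; apply: lev_add; first exact: hmono.
    by rewrite levN2.
  - move=> z zh; apply: (@archimedean _ (h 0%N)) => n.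
    suff : forall m, z *+ n <= h m by exact.
    elim: n => [|n IH] m; first by rewrite mulr0n.
    rewrite mulrS -levBrDr.
    exact: (zh (m, exist _ _ IH)).
apply/cvgr0Pnorm_lt => e /och[[N l] Nl]; exists N => // n /= Nn.
have /= := Nl (n, l) (conj Nn (lexx _)); apply: le_lt_trans.
apply: ge0_norm_le; first by rewrite subv_ge0.
by apply: lev_add => //; rewrite levN2 (svalP l).
Qed.

(** Failure of order continuity along a net yields, by repeatedly moving along
    the net, infinitely many separated jumps whose sum stays below the starting
    point. If there are no such jumps the net is Cauchy, and its limit can only
    be the infimum [0]. *)
Lemma order_continuous_criterion :
  (forall (w : nat -> X) (u : X), (forall n, 0 <= w n) ->
     (forall N, \sum_(n < N) w n <= u) -> norm_null w) ->
  order_continuous_norm X.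
Proof.
move=> wnull I leI x [i0] leIxx leIt dir xd x0 xinf.
have cau (d : R) : 0 < d -> exists i, forall j, leI i j -> `|x i - x j| < d.
  move=> d0; apply: contrapT => nd.
  have /choice[nxt nxtP] i : exists j, leI i j /\ d <= `|x i - x j|.
    apply: contrapT => ni; apply: nd; exists i => j ij.
    by rewrite ltNge; apply/negP => dij; apply: ni; exists j.
  pose a n := iter n nxt i0; pose w n := x (a n) - x (a n.+1).
  have wn0 : norm_null w.
    apply: (wnull w (x i0)) => [n|N].
      by rewrite subv_ge0 xd//; have [] := nxtP (a n).
    suff -> : \sum_(n < N) w n = x i0 - x (a N) by exact: levBl.
    elim: N => [|N IH]; first by rewrite big_ord0 subrr.
    by rewrite big_ord_recr /= IH /w addrA subrK.
  have /cvgr0Pnorm_lt/(_ d d0)/(near_infty_ex 0)[n _] := wn0.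
  by apply/negP; rewrite -leNgt; have [] := nxtP (a n).
have p2 n : (0 : R) < 2^-1 ^+ n by rewrite exprn_gt0// invr_gt0.
have /choice[c cP] n := cau _ (p2 n).
have small (e : R) : 0 < e -> \forall n \near \oo, 2^-1 ^+ n < e.
  move=> e0; have : (fun n => 2^-1 ^+ n : R) @ \oo --> (0 : R).
    by apply: cvg_expr; rewrite ger0_norm ?invr_ge0// invf_lt1// ltr1n.
  move=> /cvgr0Pnorm_lt/(_ e e0); apply: filterS => n.
  exact: le_lt_trans (ler_norm _).
have xcc (e : R) : 0 < e -> \forall n \near \oo,
    forall j, leI (c n) j -> `|x (c n) - x j| < e.
  move=> /small; apply: filterS => n en j cj.
  exact: lt_trans (cP n j cj) en.
have xc : cvgn (x \o c).
  apply: cauchy_cvg; apply/cauchyP => e e0.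
  have e2 : 0 < e / 2 by rewrite divr_gt0.
  have [m _ mP] := near_infty_ex 0 (xcc _ e2); exists (x (c m)).
  change (\forall n \near \oo, ball (x (c m)) e (x (c n))).
  move: (xcc _ e2); apply: filterS => n nP; rewrite -ball_normE /ball_ /=.
  have [k [mk nk]] := dir (c m) (c n).
  rewrite -(subrKA (x k)) (splitr e) (le_lt_trans (ler_normD _ _))//.
  by rewrite ltrD ?mP// distrC nP.
pose z := limn (x \o c); have xz : (x \o c) @ \oo --> z by exact: xc.
have zle : z <= 0.
  apply: xinf => j; rewrite -subv_ge0; apply: closed_cone => e e0.
  have e2 : 0 < e / 2 by rewrite divr_gt0.
  have /cvgrPdist_lt/(_ _ e2) xze := xz.
  have [n _ [/= xn cn]] := near_infty_ex 0 (filterI xze (xcc _ e2)).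
  have [k [jk nk]] := dir j (c n).
  exists (x j - x k); first by rewrite subv_ge0 xd.
  rewrite opprB addrC addrA subrK distrC -(subrKA (x (c n))).
  by rewrite (splitr e) (le_lt_trans (ler_normD _ _))// ltrD// cn.
move=> e e0; have /cvgrPdist_lt/(_ _ e0) xze := xz.
have [n _ /= xn] := near_infty_ex 0 xze; exists (c n) => j nj.
rewrite (le_lt_trans (ge0_norm_le (x0 j) (xd _ _ nj)))//.
rewrite (le_lt_trans _ xn)// distrC ge0_norm_le//.
by rewrite levDl// -oppr0 levN2.
Qed.

End order_continuity.

Section disjoint_weakly_null.
Context {R : realType} {X : banachLatticeType R}.

(** The components of [f] along the vectors disjoint from the first [n] terms
    of [x] decrease with [n], and passing from [n] to [n.+1] drops the value
    [f (x n)]. *)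
Lemma oc_dual_disjoint_weakly_null (x : nat -> X) :
  order_continuous_norm (dual X) -> (forall n, 0 <= x n /\ `|x n| <= 1) ->
  disjoint_seq x -> weakly_null x.
Proof.
move=> oc x01 xd f; have x0 n : 0 <= x n by have [] := x01 n.
pose A n := disjoint_complement [set x i | i in [set i | (i < n)%N]].
have cA n : positive_cone (A n).
  by apply: disjoint_complement_cone => _ [i _ <-].
pose g := labs f; have g0 : 0 <= g by exact: labs_ge0.
pose h n := component (A n) g.
have hS n : h n.+1 <= h n.
  apply: component_subset => // a [a0 ad]; split=> // _ [i /= iltn <-].
  by apply: ad; exists i => //=; rewrite ltnS ltnW.
have hx n : h n (x n) - h n.+1 (x n) = g (x n).
  have -> : h n (x n) = g (x n).
    apply: component_id => //; split=> // _ [i /= iltn <-].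
    by rewrite -(ge0_labs (x0 n)) -(ge0_labs (x0 i)) xd// gtn_eqF.
  rewrite [h n.+1 _]component_eq0 ?subr0// => a [a0 ad].
  by rewrite meetC; apply: ad; exists n => /=.
have /cvgr0Pnorm_lt hn : norm_null (fun n => h n - h n.+1).
  by apply: oc_decreasing_cauchy => // n; exact: component_ge0.
apply/cvgr0Pnorm_lt => e /hn; apply: filterS => n; apply: le_lt_trans.
rewrite (le_trans (dual_labs_le f (x0 n)))// -/g -hx -boundedOpBE.
rewrite (le_trans (ler_norm _))// (le_trans (op_normP _ _))//.
by rewrite ler_piMr ?op_norm_ge0//; have [] := x01 n.
Qed.

End disjoint_weakly_null.

(** * Weakly p-summable sequences *)

Section weak_summability.
Context {R : realType}.
Implicit Type p : R.

Lemma weakly_summable_dominated (Z Y : normedModType R) p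
    (x : nat -> Z) (y : nat -> Y) : 0 <= p ->
  (forall f : dual Z, exists g : dual Y, forall n, `|f (x n)| <= `|g (y n)|) ->
  weakly_summable p y -> weakly_summable p x.
Proof.
move=> p0 fg ys f; have [g gP] := fg f.
apply: (series_le_cvg _ _ _ (ys g)) => n; rewrite ?powR_ge0//.
by apply: ge0_ler_powR; rewrite ?nnegrE ?normr_ge0// gP.
Qed.

Lemma weakly_summable_subseq (Z : normedModType R) p (x : nat -> Z)
    (s : nat -> nat) : {homo s : i j / (i < j)%N} ->
  weakly_summable p x -> weakly_summable p (x \o s).
Proof.
move=> smono xs f; set u := fun n => `|f (x n) : R| `^ p.
have u0 n : 0 <= u n by exact: powR_ge0.
have /cvg_seq_bounded/bounded_fun_has_ubound[M uM] := xs f.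
apply: nondecreasing_is_cvgn.
  by apply: nondecreasing_series => n _ _; exact: powR_ge0.
exists M => _ [n _ <-]; apply: (@le_trans _ _ (series u (s n))); last first.
  by apply: uM; exists (s n).
elim: n => [|n IH]; first by rewrite /series /= big_geq// sumr_ge0.
rewrite /series /= big_nat_recr//= (@le_trans _ _ (series u (s n).+1))//.
  by rewrite /series /= big_nat_recr//= lerD2r.
by apply: nondecreasing_series => //; exact: smono.
Qed.

Lemma weakly_summable_weakly_null (Z : normedModType R) p (x : nat -> Z) :
  1 <= p -> weakly_summable p x -> weakly_null x.
Proof.
move=> p1 xs f; have p0 : 0 < p by exact: lt_le_trans p1.
have /cvg_series_cvg_0/cvgr0Pnorm_lt fx := xs f.
apply/cvgr0Pnorm_lt => e e0; have := fx _ (powR_gt0 p e0).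
apply: filterS => n; rewrite ger0_norm ?powR_ge0// => xe.
rewrite ltNge; apply/negP => ex; move: xe; apply/negP; rewrite -leNgt.
by apply: ge0_ler_powR; rewrite ?nnegrE ?normr_ge0 ?(ltW e0) ?(ltW p0).
Qed.

Context {X : banachLatticeType R}.

Lemma weakly_summable_le p (x y : nat -> X) : 0 <= p ->
  (forall n, 0 <= x n) -> (forall n, x n <= y n) ->
  weakly_summable p y -> weakly_summable p x.
Proof.
move=> p0 x0 xy; apply: weakly_summable_dominated => // f; exists (labs f) => n.
rewrite (le_trans (dual_labs_le f (x0 n)))//.
by rewrite (le_trans (dual_homo (labs_ge0 f) (xy n)))// ler_norm.
Qed.

(** Since the terms are disjoint, a single functional can undo all the absolute
    values: if [g'] is the component of [g >= 0] along the vectors disjoint from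
    every negative part [vpos (- x k)], then [g' + g' - g] takes on [x n] the
    value [g (labs (x n))]. *)
Lemma disjoint_weakly_summable_labs p (x : nat -> X) : 0 <= p ->
  disjoint_seq x -> weakly_summable p x ->
  weakly_summable p (fun n => labs (x n)).
Proof.
move=> p0 xd; apply: weakly_summable_dominated => // f.
pose g := labs f; have g0 : 0 <= g by exact: labs_ge0.
pose A := disjoint_complement [set vpos (- x k) | k in setT].
have cA : positive_cone A.
  by apply: disjoint_complement_cone => _ [i _ <-]; exact: vpos_ge0.
exists (component A g + component A g - g) => n.
rewrite (le_trans (dual_labs_le f (labs_ge0 _)))// -/g.
have cxp : component A g (vpos (x n)) = g (vpos (x n)).
  apply: component_id => //; split=> [|_ [k _ <-]]; first exact: vpos_ge0.
  have [->|nk] := eqVneq n k; first exact: disjoint_vpos.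
  apply: (@disjoint_le _ _ _ _ (labs (x n)) (labs (x k))).
  - exact: vpos_ge0.
  - exact: vpos_le_labs.
  - exact: vpos_ge0.
  - exact: vposN_le_labs.
  - exact: xd.
have cxn : component A g (vpos (- x n)) = 0.
  apply: component_eq0 => //; first exact: vpos_ge0.
  by move=> a [a0 ad]; rewrite meetC; apply: ad; exists n.
have cx : component A g (x n) = g (vpos (x n)).
  by rewrite -cxp -[RHS]subr0 -cxn -linearB -vpos_subN.
have gx : g (x n) = g (vpos (x n)) - g (vpos (- x n)).
  by rewrite -linearB -vpos_subN.
rewrite [in leRHS]boundedOpBE [in leRHS]boundedOpDE cx gx labs_vpos linearD/=.
by rewrite (le_trans _ (ler_norm _))//; lra.
Qed.

End weak_summability.

(** * Uniform boundedness *)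

Section uniform_boundedness.
Context {R : realType}.

Lemma pointwise_null_bounded (Z : completeNormedModType R) (f : nat -> dual Z) :
  (forall x, (fun n => f n x : R) @ \oo --> (0 : R)) ->
  exists2 M, 0 <= M & forall n, `|f n| <= M.
Proof.
move=> fx; pose F : set (Z -> R^o) := [set (f n : Z -> R^o) | n in setT].
have [|x|M MP] := @Banach_Steinhauss R Z R^o F _ _ 1.
- move=> _ [n _ <-]; split; last exact: (boundedOpP (f n)).1.
  move=> r; exists (`|f n| * r) => x xr.
  by rewrite (le_trans (op_normP _ _))// ler_wpM2l ?op_norm_ge0.
- have /cvg_norm/cvgP/cvg_seq_bounded/bounded_fun_has_ubound[M MP] := fx x.
  by exists M => _ [n _ <-]; apply: MP; exists n.
exists (Num.max M 0); first by rewrite le_max lexx orbT.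
move=> n; apply: ge_sup; first by exists `|f n 0|, 0 => //=; rewrite normr0.
move=> _ [x /= x1 <-]; rewrite le_max; apply/orP; left; apply: MP => //.
by exists n.
Qed.

Lemma eval_exists (Z : normedModType R) (x : Z) :
  exists J : dual (dual Z), forall f, J f = f x.
Proof.
have Jl : linear (fun f : dual Z => f x : R^o) by [].
have Jc : continuous (fun f : dual Z => f x : R^o).
  apply: (linear_bound_continuous Jl (M := `|x|)) => f.
  by rewrite mulrC op_normP.
by exists (BoundedOp (conj Jl Jc)).
Qed.

(** The terms of [x], seen as functionals on the dual, are pointwise null and
    hence bounded. *)
Lemma weakly_null_pairing (Z : normedModType R) (x : nat -> Z)
    (f : nat -> dual Z) : weakly_null x -> norm_null f ->
  (fun n => f n (x n) : R) @ \oo --> (0 : R).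
Proof.
move=> xn /cvgr0Pnorm_lt fn; have /choice[J JE] n := eval_exists (x n).
have [|M M0 JM] := @pointwise_null_bounded _ J.
  by move=> g; have := xn g; under eq_fun do rewrite -JE.
apply/cvgr0Pnorm_lt => e e0.
have M1 : 0 < M + 1 by rewrite ltr_wpDl.
have := fn (e / (M + 1)) (divr_gt0 e0 M1); apply: filterS => n.
rewrite ltr_pdivlMr// => /(le_lt_trans _); apply.
rewrite -JE (le_trans (op_normP _ _))// mulrC ler_wpM2l//.
by rewrite (le_trans (JM n))// lerDl.
Qed.

End uniform_boundedness.

(** * Operators through l^1 *)

Section absolutely_summing.
Context {R : realType} {X : banachLatticeType R}.
Variables (w : nat -> dual X) (u : dual X).
Hypothesis w0 : forall n, 0 <= w n.
Hypothesis wu : forall N, \sum_(n < N) w n <= u.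

Lemma sum_abs_le x N : \sum_(n < N) `|w n x| <= u (labs x).
Proof.
have uw := dual_lev (wu N) (labs_ge0 x); apply: le_trans uw.
have -> : (\sum_(n < N) w n) (labs x) = \sum_(n < N) w n (labs x).
  by elim/big_rec2 : _ => // i a b _ <-.
by apply: ler_sum => i _; exact: dual_norm_le.
Qed.

Lemma sum_operator (Z : completeNormedModType R) (c : nat -> Z) (C : R) :
  (forall n, `|c n| <= C) ->
  exists T : boundedOp X Z,
    forall x, series (fun n => w n x *: c n) @ \oo --> T x.
Proof.
move=> cC; have C0 : 0 <= C by exact: le_trans (cC 0).
pose s x := series (fun n => w n x *: c n).
have nle x N : [normed series (fun n => w n x *: c n)] N <= u (labs x) * C.
  rewrite /= /series /= big_mkord.
  rewrite (@le_trans _ _ (\sum_(n < N) `|w n x| * C))//.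
    by apply: ler_sum => n _; rewrite normrZ ler_wpM2l.
  by rewrite -mulr_suml ler_wpM2r ?sum_abs_le.
have sc x : cvgn (s x).
  apply: normed_cvg; apply: nondecreasing_is_cvgn.
    by apply: nondecreasing_series => n _ _ /=.
  by exists (u (labs x) * C) => _ [N _ <-]; exact: nle.
pose T x := limn (s x).
have sT x : s x @ \oo --> T x by exact: sc.
have Tl : linear T.
  move=> a x y; apply: cvg_lim => //.
  rewrite [X in X @ _ --> _](_ : _ = a *: s x + s y); last first.
    apply/funext => N; rewrite /s /series /= !fctE scaler_sumr -big_split/=.
    by apply: eq_bigr => n _; rewrite linearP scalerDl scalerA.
  by apply: cvgD; [exact: cvgZr|].
have Tc : continuous T.
  apply: (linear_bound_continuous Tl (M := `|u| * C)) => x.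
  have c1 : (fun N => `|s x N|) @ \oo --> `|T x| by exact: cvg_norm.
  have -> : `|T x| = limn (fun N => `|s x N|) by exact/esym/cvg_lim.
  apply: limr_le; first exact: cvgP c1.
  apply: nearW => N; rewrite (le_trans (ler_norm_sum _ _ _))//.
  rewrite (le_trans (nle x N))// mulrAC ler_wpM2r//.
  by rewrite (le_trans (ler_norm _))// (le_trans (op_normP _ _))// norm_labs.
by exists (BoundedOp (conj Tl Tc)).
Qed.

(** A gliding hump: were the sums not small along [x], disjoint consecutive
    blocks of indices would carry almost all of the mass of suitable terms of
    [x]; the functional obtained by summing [w] with the signs read off these
    blocks would then stay away from [0] on those terms. *)
Lemma schur (x : nat -> X) (e : R) : weakly_null x -> 0 < e ->
  \forall m \near \oo, forall N, \sum_(n < N) `|w n (x m)| <= e.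
Proof.
move=> xn e0; apply: contrapT => ne.
pose S m N := \sum_(n < N) `|w n (x m)|.
have Smono m i j : (i <= j)%N -> S m i <= S m j.
  move=> ij; rewrite /S -!(big_mkord predT (fun n => `|w n (x m)|)).
  by rewrite (big_cat_nat (leq0n i) ij)//= lerDl sumr_ge0.
have e8 : 0 < e / 8 by rewrite divr_gt0.
have bad M : exists m N, [/\ (M <= m)%N & e < S m N].
  apply: contrapT => nb; apply: ne; exists M => // m /= Mm N.
  by rewrite leNgt; apply/negP => eS; apply: nb; exists m, N.
have tail m : exists N1, forall N, S m N <= S m N1 + e / 8.
  have hs : has_sup (range (S m)).
    split; first by exists (S m 0), 0.
    by exists (u (labs (x m))) => _ [N _ <-]; exact: sum_abs_le.
  have [_ [N1 _ <-] N1P] := sup_adherent e8 hs; exists N1 => N.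
  rewrite -lerBlDr (le_trans _ (ltW N1P))// lerB//.
  by apply: ub_le_sup; [exact: hs.2|exists N].
have head N0 : \forall m \near \oo, S m N0 <= e / 8.
  have c0 : (fun m => S m N0) @ \oo --> (0 : R).
    elim: N0 => [|N0 IH].
      by under eq_fun do rewrite /S big_ord0; exact: cvg_cst.
    have c : (fun m => `|w N0 (x m)|) @ \oo --> (0 : R).
      by have := cvg_norm (xn (w N0)); rewrite normr0; apply.
    have -> : (fun m => S m N0.+1) =
        (fun m => S m N0) \+ (fun m => `|w N0 (x m)|).
      by apply/funext => m; rewrite /S big_ord_recr.
    by have := cvgD IH c; rewrite addr0; apply.
  have /cvgr0Pnorm_lt/(_ _ e8) := c0; apply: filterS => m me.
  by rewrite (le_trans (ler_norm _))// ltW.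
have step N0 : exists mN : nat * nat, [/\ (N0 <= mN.1)%N, (N0 < mN.2)%N,
    S mN.1 N0 <= e / 8, e < S mN.1 mN.2 &
    forall N, S mN.1 N <= S mN.1 mN.2 + e / 8].
  have [M _ MP] := head N0; have [m [N [Mm eS]]] := bad (maxn M N0).
  move: Mm; rewrite geq_max => /andP[Mm Nm].
  have [N1 N1P] := tail m.
  exists (m, maxn N0.+1 (maxn N N1)); split=> //=.
  - by rewrite leq_maxl.
  - exact: MP.
  - by rewrite (lt_le_trans eS)// Smono// leq_max leq_max leqnn orbT.
  - move=> k; rewrite (le_trans (N1P k))// lerD2r Smono//.
    by rewrite leq_max leq_max leqnn !orbT.
have /choice[g gP] := step.
pose N k := iter k (fun n => (g n).2) 0%N; pose m k := (g (N k)).1.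
have NS k : (N k < N k.+1)%N by have [] := gP (N k).
have Nhomo : {homo N : i j / (i <= j)%N}.
  by apply: homo_leq => [//|? ? ?|k]; [exact: leq_trans|exact: ltnW].
have kN k : (k <= N k)%N by elim: k => // k IH; exact: leq_ltn_trans IH (NS k).
have /choice[kap kapP] n : exists k, (N k <= n < N k.+1)%N.
  elim: n => [|n [k /andP[kn nk]]]; first by exists 0; rewrite /= (NS 0).
  have [nk1|kn1] := ltnP n.+1 (N k.+1).
    by exists k; rewrite nk1 (leq_trans kn).
  by exists k.+1; rewrite kn1 (leq_ltn_trans nk (NS _)).
have kapE k n : (N k <= n)%N -> (n < N k.+1)%N -> kap n = k.
  move=> kn nk; have /andP[an na] := kapP n; apply/eqP; rewrite eqn_leq.
  apply/andP; split; rewrite leqNgt; apply/negP => /Nhomo lt.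
    by have := leq_ltn_trans (leq_trans lt an) nk; rewrite ltnn.
  by have := leq_ltn_trans (leq_trans lt kn) na; rewrite ltnn.
(* [kap n] is the block containing [n]. *)
pose b n : R^o := Num.sg (w n (x (m (kap n)))).
have b1 n : `|b n| <= 1.
  by rewrite /b normr_sg; case: eqP => _ //=; rewrite ler01.
have [h hP] := sum_operator b1.
have hx k : e / 2 <= `|h (x (m k))|.
  have [_ Nk head_le mass tail_le] := gP (N k).
  rewrite -/(m k) -[(g (N k)).2]/(N k.+1) in Nk head_le mass tail_le.
  have hc : (fun M => `|series (fun n => w n (x (m k)) *: b n) M|) @ \oo -->
      `|h (x (m k))| by apply: cvg_norm; exact: hP.
  have -> : `|h (x (m k))| =
      limn (fun M => `|series (fun n => w n (x (m k)) *: b n) M|).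
    exact/esym/cvg_lim.
  apply: limr_ge; first exact: cvgP hc.
  exists (N k.+1) => // M /= kM.
  pose v n := w n (x (m k)); pose a i j := \sum_(i <= n < j) `|v n|.
  have SE i : S (m k) i = a 0%N i by rewrite /S /a big_mkord.
  have aD i j l : (i <= j)%N -> (j <= l)%N -> a i l = a i j + a j l.
    by move=> ij jl; rewrite /a (big_cat_nat ij jl).
  have sD (F : nat -> R) i j l : (i <= j)%N -> (j <= l)%N ->
      \sum_(i <= n < l) F n = \sum_(i <= n < j) F n + \sum_(j <= n < l) F n.
    by move=> ij jl; rewrite (big_cat_nat ij jl).
  have sle i j : `|\sum_(i <= n < j) v n * b n| <= a i j.
    rewrite (le_trans (ler_norm_sum _ _ _))// ler_sum// => n _.
    by rewrite normrM ler_piMr.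
  have mid : \sum_(N k <= n < N k.+1) v n * b n = a (N k) (N k.+1).
    apply: eq_big_nat => n /andP[kn nk].
    by rewrite /b (kapE k)// -/(v n) mulrC -normrEsg.
  rewrite /series /= -[X in `|X|]/(\sum_(0 <= n < M) v n * b n).
  rewrite (sD _ _ (N k) M)//; last exact: leq_trans (ltnW Nk) kM.
  rewrite (sD _ (N k) (N k.+1) M)//; last exact: ltnW.
  rewrite mid.
  have h1 := sle 0%N (N k); have h3 := sle (N k.+1) M.
  have t1 := tail_le M.
  rewrite !SE (aD 0%N (N k) (N k.+1))// ?(ltnW Nk)// in head_le mass t1.
  rewrite (aD 0%N (N k) M)// ?(leq_trans (ltnW Nk))// in t1.
  rewrite (aD (N k) (N k.+1) M)// ?(ltnW Nk)// in t1.
  move: h1 h3; rewrite !ler_norml => /andP[h1 _] /andP[h3 _].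
  apply: le_trans (ler_norm _); lra.
have /cvgr0Pnorm_lt/(_ (e / 2)) := xn h.
rewrite divr_gt0// => /(_ isT)[K _ KP].
have : `|h (x (m K))| < e / 2.
  by apply: KP => /=; have [NK _ _ _ _] := gP (N K); exact: leq_trans (kN K) NK.
by rewrite ltNge hx.
Qed.

End absolutely_summing.

(** * The three implications *)

Section implications.
Context {R : realType} {E F : banachLatticeType R}.
Variable p : R.
Hypothesis p1 : 1 <= p.
Implicit Type T : boundedOp E F.

Let p0 : 0 <= p. Proof. exact: le_trans p1. Qed.

Lemma summable_weak_star_null (y : nat -> dual F) (x : F) :
  weakly_summable p y -> (fun n => y n x : R) @ \oo --> (0 : R).
Proof.
move=> /(weakly_summable_weakly_null p1) yn; have [J JE] := eval_exists x.
by have := yn J; under eq_fun do rewrite JE.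
Qed.

Lemma disjoint_labs (y : nat -> dual F) : disjoint_seq y ->
  disjoint_seq (fun n => labs (y n)).
Proof. by move=> yd n m nm; rewrite !(ge0_labs (labs_ge0 _)) yd. Qed.

Lemma adjoint_ge0 T (f : dual F) : positive_op T -> 0 <= f ->
  0 <= adjoint T f.
Proof.
move=> Tpos f0; apply/dual_ge0P => x x0.
by rewrite adjointE dual_apply_ge0// Tpos.
Qed.

Lemma norm_adjoint_labs T (f : dual F) : positive_op T ->
  `|adjoint T f| <= `|adjoint T (labs f)|.
Proof.
move=> Tpos; apply: labs_le_norm.
rewrite [in leRHS](ge0_labs (adjoint_ge0 Tpos (labs_ge0 f))); apply: labs_le.
  by apply/dual_leP => x x0; exact: (dual_lev (labs_ge f) (Tpos _ x0)).
by apply/dual_leP => x x0; exact: (dual_lev (labs_geN f) (Tpos _ x0)).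
Qed.

Lemma adjoint_disjoint_convergent T :
  order_continuous_norm (dual E) \/ positive_schur p (dual F) ->
  positive_op T -> almost_weak_convergent p T ->
  disjoint_convergent p (adjoint T).
Proof.
move=> ocs Tpos awp y yd ys; pose z n := labs (y n).
have zd : disjoint_seq z by exact: disjoint_labs.
have zs : weakly_summable p z by exact: disjoint_weakly_summable_labs.
suff /cvgr0Pnorm_lt zn : norm_null (fun n => adjoint T (z n)).
  apply/cvgr0Pnorm_lt => e /zn; apply: filterS => n; apply: le_lt_trans.
  exact: norm_adjoint_labs.
case: ocs => [oc|schurF]; last first.
  have zn : norm_null z by apply: schurF => // n; exact: labs_ge0.
  rewrite /norm_null -(linear0 (adjoint T)).
  exact: (continuous_cvg _ (@boundedOp_continuous _ _ _ (adjoint T) 0) zn).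
apply: contrapT => Tzn.
have [|x|e [s [v [e0 smono v01 vd ev]]]] := dodds_fremlin _ _ Tzn.
- by move=> n; exact/adjoint_ge0/labs_ge0.
- exact: summable_weak_star_null.
have vn : weakly_null v by exact: oc_dual_disjoint_weakly_null.
have zsd : disjoint_seq (z \o s).
  move=> i j ij /=; apply: zd; move: ij.
  by rewrite !neq_ltn => /orP[] /smono ->; rewrite ?orbT.
have /cvgr0Pnorm_lt/(_ e e0)/(near_infty_ex 0)[n _ /=] :=
  awp _ _ vn zsd (weakly_summable_subseq smono zs).
apply/negP; rewrite -leNgt (le_trans (ev n))//; exact: ler_norm.
Qed.

Lemma almost_weak_convergent_adjoint T :
  disjoint_convergent p (adjoint T) -> almost_weak_convergent p T.
Proof.
move=> Tdc x y xn yd ys.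
exact: (weakly_null_pairing xn (Tdc _ yd ys)).
Qed.

(** The vectors [v k] produced by [dodds_fremlin] are disjoint, so the
    components of the functionals along the rays through the [v k] are disjoint
    as well; they keep their values on [v k], and being positive and dominated
    by the original functionals they are weakly summable. *)
Lemma not_positive_schur : ~ positive_schur p (dual F) ->
  exists (e : R) (f : nat -> dual F) (v : nat -> F),
    [/\ 0 < e, forall k, 0 <= f k, disjoint_seq f & weakly_summable p f] /\
    [/\ forall k, 0 <= v k, forall k, `|v k| <= 1 & forall k, e <= f k (v k)].
Proof.
move=> nschur.
have [y [y0 ys yn]] : exists y : nat -> dual F,
    [/\ forall n, 0 <= y n, weakly_summable p y & ~ norm_null y].
  apply: contrapT => ny; apply: nschur => y y0 ys; apply: contrapT => yn.
  by apply: ny; exists y.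
have [x|e [s [v [e0 smono v01 vd ev]]]] := dodds_fremlin y0 _ yn.
  exact: summable_weak_star_null.
have v0 k : 0 <= v k by have [] := v01 k.
have cv k := ray_cone (v0 k).
exists e, (fun k => component (ray (v k)) (y (s k))), v; split; split=> //.
- by move=> k; exact: component_ge0.
- apply: disjoint_seq_ge0 => [k|j k jk]; first exact: component_ge0.
  apply: component_disjoint => // _ _ [a a0 <-] [b b0 <-].
  rewrite disjoint_scalev ?scalev_ge0// meetC disjoint_scalev// meetC.
  by rewrite -(ge0_labs (v0 j)) -(ge0_labs (v0 k)) vd// ltn_eqF.
- apply: (weakly_summable_le p0 _ _ (weakly_summable_subseq smono ys)) => k.
    exact: component_ge0.
  exact: component_lef.
- by move=> k; have [] := v01 k.
- by move=> k; rewrite component_id//; exact: ray_refl.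
Qed.

(** For positive [w n] on [E] whose partial sums are order bounded, and [f],
    [v], [e] from [not_positive_schur], the operator
    [x |-> \sum_n w n x *: v n] is almost weak p-convergent by [schur], and its
    adjoint maps [f k] to a functional above [e *: w k]. Hence [w] is norm
    null. *)
Lemma oc_dual_of_adjoints :
  (forall T, positive_op T ->
    almost_weak_convergent p T -> disjoint_convergent p (adjoint T)) ->
  order_continuous_norm (dual E) \/ positive_schur p (dual F).
Proof.
move=> adj; have [schurF|nschur] := pselect (positive_schur p (dual F)).
  by right.
left; apply: order_continuous_criterion => w u w0 wu.
have [e [f [v [[e0 f0 fd fs] [v0 v1 fv]]]]] := not_positive_schur nschur.
have [T TE] := sum_operator w0 wu v1.
have Tpos : positive_op T.
  move=> x x0; apply: (lev_lim (TE x)); apply: nearW => N.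
  apply: sumv_ge0 => n _.
  exact: scalev_ge0 (dual_apply_ge0 (w0 n) x0) (v0 n).
have Tnorm x e' : (forall N, \sum_(n < N) `|w n x| <= e') -> `|T x| <= e'.
  move=> we.
  have c1 : (fun N => `|series (fun n => w n x *: v n) N|) @ \oo --> `|T x|.
    by apply: cvg_norm; exact: TE.
  have -> : `|T x| = limn (fun N => `|series (fun n => w n x *: v n) N|).
    exact/esym/cvg_lim.
  apply: limr_le; first exact: cvgP c1.
  apply: nearW => N; rewrite (le_trans _ (we N))// /series /= big_mkord.
  rewrite (le_trans (ler_norm_sum _ _ _))// ler_sum// => n _.
  by rewrite normrZ ler_piMr.
have awp : almost_weak_convergent p T.
  move=> x y xn yd ys.
  have [M M0 yM] : exists2 M, 0 <= M & forall n, `|y n| <= M.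
    by apply: pointwise_null_bounded => z; exact: summable_weak_star_null.
  apply/cvgr0Pnorm_lt => d d0; have M1 : 0 < M + 1 by rewrite ltr_wpDl.
  have := schur w0 wu xn (divr_gt0 d0 M1); apply: filterS => n /Tnorm Td.
  rewrite (le_lt_trans (op_normP _ _))//.
  rewrite (@le_lt_trans _ _ (M * (d / (M + 1))))//.
    by apply: ler_pM => //; rewrite ?op_norm_ge0 ?yM.
  by rewrite mulrCA gtr_pMr// ltr_pdivrMr// mul1r ltrDl.
have /cvgr0Pnorm_lt Tf := adj T Tpos awp f fd fs.
have wT k : e *: w k <= adjoint T (f k).
  apply/dual_leP => x x0; rewrite boundedOpZE adjointE.
  have wx0 : 0 <= w k x := dual_apply_ge0 (w0 k) x0.
  rewrite (@le_trans _ _ (f k (w k x *: v k)))//.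
    by rewrite linearZ/= [leLHS]mulrC ler_wpM2l.
  apply: dual_homo => //; apply: (lev_lim (TE x)).
  exists k.+1 => // N /= kN; rewrite /series /= big_mkord.
  rewrite (bigD1 (Ordinal kN))//= levDl// sumv_ge0// => n _.
  exact: scalev_ge0 (dual_apply_ge0 (w0 n) x0) (v0 n).
apply/cvgr0Pnorm_lt => d d0; have := Tf _ (mulr_gt0 e0 d0); apply: filterS => k.
move=> Tfk; rewrite -(ltr_pM2l e0) (le_lt_trans _ Tfk)//.
rewrite -[X in X * _](gtr0_norm e0) -normrZ.
by apply: ge0_norm_le => //; rewrite scalev_ge0 ?(ltW e0).
Qed.

End implications.

Theorem theorem3p12 (R : realType) (p : R) (E F : banachLatticeType R)
    (p_ge1 : 1 <= p) :
  [<-> order_continuous_norm (dual E) \/ positive_schur p (dual F);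
       forall T : boundedOp E F, positive_op T ->
         almost_weak_convergent p T -> disjoint_convergent p (adjoint T);
       forall T : boundedOp E F, positive_op T ->
         (almost_weak_convergent p T <-> disjoint_convergent p (adjoint T))].
Proof.
tfae.
- by move=> a T; exact: adjoint_disjoint_convergent.
- move=> b T Tpos; split; first exact: b.
  exact: almost_weak_convergent_adjoint.
- by move=> c; apply: oc_dual_of_adjoints => // T /c[].
Qed.
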